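(* Let $(X,Y)$ be a bivariate random vector. Assume that there exist functions $m$, $a>0$ and $\psi>0$ and a bivariate distribution function $K$ on $[0,\infty)\times(-\infty,\infty)$ with non-degenerate margins such that $$\lim_{t\to\infty}\mathbb{P}\bigl(X\le t+\psi(t)x\,;\,Y\le m(t)+a(t)y\,\big|\,X>t\bigr)=K(x,y)$$ at all points of continuity $(x,y)$ of $K$. Assume that $Y$ belongs to the domain of attraction of an extreme value distribution $G_\gamma$ with auxiliary function $\psi_Y$, i.e. $$\lim_{t\to\infty}\mathbb{P}(Y>t+\psi_Y(t)y\mid Y>t)=-\log G_\gamma(y).$$ Assume moreover that for all $y\in\mathbb{R}$, $$\lim_{t\to\infty}\frac{b_Y(t)-m\circ b_X(t)+\psi_Y\circ b_Y(t)\,y}{a\circ b_X(t)}=+\infty,$$ where $b_X$ and $b_Y$ are the inverse functions of $1/\mathbb{P}(X>\cdot)$ and of $1/\mathbb{P}(Y>\cdot)$, respectively. Then $(X,Y)$ belongs to the domain of attraction of a bivariate extreme value distribution with independent marginals, i.e. $X$ and $Y$ are asymptotically independent.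
   Context: The extreme value distribution with index $\gamma$ is $G_\gamma(y)=\exp\{-(1+\gamma y)^{-1/\gamma}\}$ for each $y$ with $1+\gamma y>0$ when $\gamma\ne0$, and $G_0(y)=\exp\{-\mathrm{e}^{-y}\}$. Limits defining the domain of attraction are required at each $y$ with $1+\gamma y>0$ (each real $y$ if $\gamma=0$). The paper's standing convention is that right endpoints of supports are infinite. Inverse functions are understood as (left-continuous) generalized inverses, e.g. $b_X(t)=\inf\{x:1/\mathbb{P}(X>x)\ge t\}$. Two random variables $X$ and $Y$ such that $(X,Y)$ belongs to the maximum domain of attraction of a bivariate extreme value distribution $G$ (i.e. suitably affinely normalized componentwise maxima of i.i.d. copies of $(X,Y)$ converge weakly to $G$, with non-degenerate marginals) are called asymptotically independent if $G$ has independent marginals, i.e. is the product of its marginals. *)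

(* Defs.v *)
From HB Require Import structures.
From mathcomp Require Import all_boot all_order all_algebra.
From mathcomp Require Import all_classical all_reals all_analysis.

Set Implicit Arguments.
Unset Strict Implicit.
Unset Printing Implicit Defensive.

Import Order.TTheory GRing.Theory Num.Theory.
Import numFieldNormedType.Exports.

Local Open Scope classical_set_scope.
Local Open Scope ring_scope.

Definition cond_prob (R : realType) (d : measure_display) (T : measurableType d)
    (P : probability T R) (A B : set T) : R :=
  fine (P (A `&` B)) / fine (P B).

Definition tail (R : realType) (d : measure_display) (T : measurableType d)
    (P : probability T R) (Z : {RV P >-> R}) (x : R) : R :=
  fine (ccdf Z x).

(** Left-continuous generalized inverse of [x |-> 1 / P(Z > x)]. [inf] is
    meaningful for [t > 1], where the set is bounded below. *)
Definition tail_inverse (R : realType) (d : measure_display)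
    (T : measurableType d) (P : probability T R) (Z : {RV P >-> R}) (t : R) : R :=
  inf [set x | t <= (tail Z x)^-1].

Definition evd (R : realType) (gamma y : R) : R :=
  if gamma == 0 then expR (- expR (- y))
  else expR (- ((1 + gamma * y) `^ (- gamma^-1))).

(** The limit relation is read as the convergence of
    [P(Z > t + psi(t) y) / P(Z > t)], which is the conditional probability of
    [Z > t + psi(t) y] given [Z > t] when [0 <= psi(t) y]; for [y < 0] the
    conditional probability is [1] whereas [- ln (evd gamma y) > 1]. *)
Definition in_evd_domain (R : realType) (d : measure_display)
    (T : measurableType d) (P : probability T R) (Z : {RV P >-> R})
    (gamma : R) (psi : R -> R) : Prop :=
  forall y : R, 0 < 1 + gamma * y ->
    tail Z (t + psi t * y) / tail Z t @[t --> +oo] --> - ln (evd gamma y).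

(** A bivariate distribution function is given by the probability measure on
    the plane that it determines; its continuity points are those of a function
    on the whole plane, also when the measure sits on a half-plane. *)
Definition bicdf (R : realType) (mu : probability (R * R)%type R)
    (z : R * R) : R :=
  fine (mu [set u | u.1 <= z.1 /\ u.2 <= z.2]).

Definition margin1 (R : realType) (mu : probability (R * R)%type R)
    (x : R) : R := fine (mu [set u | u.1 <= x]).

Definition margin2 (R : realType) (mu : probability (R * R)%type R)
    (y : R) : R := fine (mu [set u | u.2 <= y]).

Definition nondegenerate_margins (R : realType)
    (mu : probability (R * R)%type R) : Prop :=
  (forall c : R, mu [set u | u.1 = c] <> 1%E) /\
  (forall c : R, mu [set u | u.2 = c] <> 1%E).

Definition independent_margins (R : realType)
    (mu : probability (R * R)%type R) : Prop :=
  forall x y : R, bicdf mu (x, y) = margin1 mu x * margin2 mu y.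

(** The product rule over the whole family, for arbitrary measurable sets, gives
    the product rule over subfamilies by taking the other sets to be [setT]. *)
Definition mutually_independent (R : realType) (d d' : measure_display)
    (T : measurableType d) (V : measurableType d') (P : probability T R)
    (n : nat) (Z : 'I_n -> {RV P >-> V}) : Prop :=
  forall A : 'I_n -> set V, (forall i, measurable (A i)) ->
    P (\bigcap_i (Z i @^-1` A i)) = (\prod_(i < n) P (Z i @^-1` A i))%E.

Definition iid_copies (R : realType) (d0 d d' : measure_display)
    (T0 : measurableType d0) (T : measurableType d) (V : measurableType d')
    (P0 : probability T0 R) (Z0 : T0 -> V) (P : probability T R)
    (n : nat) (Z : 'I_n -> {RV P >-> V}) : Prop :=
  (forall (i : 'I_n) (A : set V), measurable A ->
     P (Z i @^-1` A) = P0 (Z0 @^-1` A)) /\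
  mutually_independent Z.

Lemma iid_copies_exist (R : realType) (d0 d' : measure_display)
    (T0 : measurableType d0) (V : measurableType d') (P0 : probability T0 R)
    (Z0 : {RV P0 >-> V}) (n : nat) :
  exists (d : measure_display) (T : measurableType d) (P : probability T R)
    (Z : 'I_n -> {RV P >-> V}), iid_copies P0 Z0 Z.
Proof.
elim: n => [|n [d [T [P [Z [eqZ indZ]]]]]].
  exists d0, T0, P0, (fun=> Z0); split=> [[]//|A _].
  rewrite big_ord0 (_ : \bigcap_i _ = setT) ?probability_setT//.
  by apply/seteqP; split=> // w _ [].
have QT : (P0 \x P)%E setT = 1%E.
  rewrite -setXTT; apply: (etrans (product_measure1E _ _ _ _)) => //.
  by rewrite -[LHS]/(P0 setT * P setT)%E !probability_setT mule1.
pose B := Measure_isProbability.Build _ _ _ (P0 \x P)%E QT.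
pose P1 : probability (T0 * T)%type R := HB.pack (P0 \x P)%E B.
have P1E A C : measurable A -> measurable C -> P1 (A `*` C) = (P0 A * P C)%E.
  by move=> mA mC; exact: product_measure1E.
pose W (i : 'I_n.+1) (w : T0 * T) : V :=
  if unlift ord0 i is Some j then Z j w.2 else Z0 w.1.
have mW i : measurable_fun setT (W i).
  rewrite /W; case: unlift => [j|].
    exact: (measurableT_comp (measurable_funPT (Z j)) measurable_snd).
  exact: (measurableT_comp (measurable_funPT Z0) measurable_fst).
pose Y i : {RV P1 >-> V} := mfun_Sub (mem_set (mW i)).
have YE i : Y i = W i :> (_ -> _) by [].
have mP (f : T0 -> V) A : measurable_fun setT f -> measurable A ->
    measurable (f @^-1` A).
  by move=> mf mA; rewrite -[X in measurable X]setTI; exact: mf.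
have mZ0 A : measurable A -> measurable (Z0 @^-1` A).
  by move=> mA; rewrite -[X in measurable X]setTI; exact: measurable_funPT.
have mZ j A : measurable A -> measurable (Z j @^-1` A).
  by move=> mA; rewrite -[X in measurable X]setTI; exact: measurable_funPT.
have law i A : measurable A -> P1 (Y i @^-1` A) = P0 (Z0 @^-1` A).
  move=> mA; rewrite YE /W; case: unlift => [j|].
    rewrite (_ : _ @^-1` _ = setT `*` (Z j @^-1` A)); last first.
      by apply/seteqP; split=> w //= [].
    by rewrite P1E ?probability_setT ?mul1e ?eqZ//; exact: mZ.
  rewrite (_ : _ @^-1` _ = (Z0 @^-1` A) `*` setT); last first.
    by apply/seteqP; split=> w //= [].
  by rewrite P1E ?probability_setT ?mule1//; exact: mZ0.
exists _, _, P1, Y; split=> // A mA.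
have lawE : (\prod_(i < n.+1) P1 (Y i @^-1` A i) =
    P0 (Z0 @^-1` A ord0) * \prod_(i < n) P (Z i @^-1` A (lift ord0 i)))%E.
  rewrite big_ord_recl; congr (_ * _)%E; first exact: law.
  by apply: eq_bigr => i _; rewrite law// eqZ.
rewrite lawE -(indZ (fun i => A (lift ord0 i)))// -P1E//; last 2 first.
- exact: mZ0.
- by apply: fin_bigcap_measurable => [|i _]; [exact: finite_finset|exact: mZ].
have Y0 w : Y ord0 w = Z0 w.1 by rewrite YE /W unlift_none.
have YL i w : Y (lift ord0 i) w = Z i w.2 by rewrite YE /W liftK.
congr (P1 _); apply/seteqP; split=> [w h|w [h0 h] i _].
  split; first by rewrite /preimage/= -Y0; exact: h.
  by move=> i _; rewrite /preimage/= -YL; exact: h.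
case: (unliftP ord0 i) => [j|] ->; rewrite /preimage /mkset.
  by rewrite YL; exact: h.
by rewrite Y0.
Qed.

Definition componentwise_max (R : realType) (T : Type) (n : nat)
    (Z : 'I_n.+1 -> T -> R * R) (w : T) : R * R :=
  (\big[Num.max/(Z ord0 w).1]_(i < n.+1) (Z i w).1,
   \big[Num.max/(Z ord0 w).2]_(i < n.+1) (Z i w).2).

(** Only the law of the maximum of [n.+1] copies matters, so the copies for
    different [n] may live on different probability spaces; [iid_copies_exist]
    shows that the quantification over copies is not void. [G] is then a
    bivariate extreme value distribution by definition. *)
Definition in_max_domain (R : realType) (d : measure_display)
    (T : measurableType d) (P : probability T R) (X Y : {RV P >-> R})
    (G : probability (R * R)%type R) : Prop :=
  nondegenerate_margins G /\
  exists a1 b1 a2 b2 : nat -> R,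
    (forall n, 0 < a1 n) /\ (forall n, 0 < a2 n) /\
    forall (d' : nat -> measure_display) (S : forall n, measurableType (d' n))
      (Q : forall n, probability (S n) R)
      (Z : forall n, 'I_n.+1 -> {RV Q n >-> (R * R)%type}),
      (forall n, iid_copies P (fun w => (X w, Y w)) (Z n)) ->
      forall z : R * R, {for z, continuous (bicdf G)} ->
        (fun n => fine (Q n [set w |
            let M := componentwise_max (Z n) w in
            (M.1 - b1 n) / a1 n <= z.1 /\ (M.2 - b2 n) / a2 n <= z.2]))
          @ \oo --> bicdf G z.

Definition asymptotically_independent (R : realType) (d : measure_display)
    (T : measurableType d) (P : probability T R) (X Y : {RV P >-> R}) : Prop :=
  exists G : probability (R * R)%type R,
    in_max_domain X Y G /\ independent_margins G.

(* Main.v *)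
From HB Require Import structures.
Require Import Defs.
From mathcomp Require Import all_boot all_order all_algebra.
From mathcomp Require Import all_classical all_reals all_analysis.
From mathcomp Require Import measurable_realfun ring lra.

(** The law of the maximum of [n] copies of [(X, Y)] at a level [(u, v)] is
    [(1 - q) ^+ n], where [q] is the probability that [X] exceeds [u] or [Y]
    exceeds [v], so it converges to [expR (- (x + y - j))] when the expected
    numbers of exceedances [n * P(X > u)], [n * P(Y > v)] and
    [n * P(X > u, Y > v)] converge to [x], [y] and [j]. The limit has independent
    margins once both margins converge and [j = 0].

    That [j = 0] is where the separation condition enters. Levels with at most
    [L] expected exceedances lie above the quantiles of [X] and [Y] of order
    [1 - L / n]. Given that [X] exceeds its quantile [s], the conditional limit
    says that [Y] lives at the scale [m s + a s * y], and separation puts the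
    quantile of [Y] beyond every such level ([joint_tail_negligible]).

    The convergence of the margin of [Y] is almost its hypothesis; only
    [t * P(Y > b_Y(t)) --> 1] must be checked. That of [X] has to be extracted
    from the conditional limit, whose first margin says that the excesses of [X]
    over a threshold [t], divided by [psi t], have a nondegenerate limit with some
    survival function [H]. Comparing the thresholds [t] and [t + psi t * x] shows
    that [H] beyond [x] is a rescaled copy of [H] ([excess_stability]). Such an [H]
    is continuous and strictly decreasing until it vanishes. Continuity gives
    [t * P(X > b_X(t)) --> 1] ([inv_tail_atomless]), inversion gives the
    convergence of the normalized quantiles
    [(b_X(s * t) - b_X(t)) / psi (b_X(t))] for [s > 1], and comparing the
    quantiles at two orders from two thresholds gives the convergence of the
    ratios of scales, hence that of the normalized quantiles for all [s > 0], to
    a strictly increasing function [E] ([quantile_limit]).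

    For both margins the outcome is
    [n * P(Z > b n + a n * E s) --> s^-1] for all [s > 0] with [E] strictly
    increasing. The limit law of the normalized maxima is then that of [E xi] with
    [xi] unit Frechet ([quantile_law_exists], [intensity_cvg]), and the product of
    the two laws is the required limit. *)

Set Implicit Arguments.
Unset Strict Implicit.
Unset Printing Implicit Defensive.

Import Order.TTheory GRing.Theory Num.Theory.
Import numFieldNormedType.Exports.

Local Open Scope classical_set_scope.
Local Open Scope ring_scope.

(** * Convergence and monotonicity tools *)

(** Survival functions with infinite right endpoint; right-continuity and the
    limits at infinity are in the epsilon form in which they get used. *)
Definition unbounded_survival (R : realType) (f : R -> R) : Prop :=
  [/\ {homo f : x y / x <= y >-> y <= x},
      (forall x, 0 < f x),
      (forall x e, 0 < e -> exists2 y, x < y & f x - e < f y),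
      (forall e, 0 < e -> exists x, f x < e) &
      (forall e, e < 1 -> exists x, e < f x)].

(** Survival functions of nonnegative random variables; unlike
    [unbounded_survival], they may vanish, as excess limits do a priori. *)
Definition excess_survival (R : realType) (H : R -> R) : Prop :=
  [/\ {homo H : x y / x <= y >-> y <= x},
      (forall x, 0 <= H x <= 1),
      (forall x e, 0 < e -> exists2 y, x < y & H x - e < H y),
      (forall e, 0 < e -> exists x, H x < e) &
      (forall x, x < 0 -> H x = 1)].

Lemma nonincreasing_lt_arg (R : realType) (g : R -> R) (u v : R) :
  {homo g : x y / x <= y >-> y <= x} -> g u < g v -> v < u.
Proof. by move=> g_ni; apply: contraTT; rewrite -!leNgt => /g_ni. Qed.

(** Tail functions are monotone in their argument, so limits come as one-sided
    comparisons with nearby constants; [d] lets these constants keep a sign. *)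
Lemma cvg_between (R : realType) (I : Type) (F : set_system I) {FF : Filter F}
    (g : I -> R) (l d : R) : 0 < d ->
  (forall x, l - d < x < l -> \forall t \near F, x <= g t) ->
  (forall x, l < x < l + d -> \forall t \near F, g t <= x) ->
  g t @[t --> F] --> l.
Proof.
move=> d0 lo up; apply/cvgrPdist_lt => e e0.
pose m := Num.min e d / 2.
have m0 : 0 < m by rewrite divr_gt0// lt_min e0.
have [me md] : 2 * m <= e /\ 2 * m <= d.
  by rewrite /m mulrC divfK// !ge_min !lexx orbT.
have h1 := lo (l - m) ltac:(apply/andP; split; lra).
have h2 := up (l + m) ltac:(apply/andP; split; lra).
near=> t.
have : l - m <= g t by near: t.
have : g t <= l + m by near: t.
by rewrite ltr_norml => ? ?; apply/andP; split; lra.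
Unshelve. all: by end_near. Qed.

Lemma cvg_ext (R : realType) (I : Type) (F : set_system I) (h g : I -> R)
    (l : R) : h t @[t --> F] --> l -> g =1 h -> g t @[t --> F] --> l.
Proof. by move=> hl /funext ->. Qed.

Lemma cvg_near_ext (R : realType) (I : Type) (F : set_system I) {FF : Filter F}
    (h g : I -> R) (l : R) :
  h t @[t --> F] --> l -> (\forall t \near F, h t = g t) -> g t @[t --> F] --> l.
Proof. by move=> hl /near_eq_cvg/cvg_trans; apply. Qed.

Lemma cvg_scale_pinfty (R : realType) (s : R) : 0 < s ->
  (s * t) @[t --> +oo] --> +oo.
Proof.
move=> s0; apply/cvgryPge => A; near=> t.
by rewrite mulrC -ler_pdivrMr//; near: t.
Unshelve. all: by end_near. Qed.

Lemma geometric_small (R : realType) (c e : R) : 0 <= c < 1 -> 0 < e ->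
  exists n, c ^+ n < e.
Proof.
move=> /andP[c0 c1] e0.
have cv : (fun n => c ^+ n) @ \oo --> 0 by apply: cvg_expr; rewrite ger0_norm.
by have [n _ hn] := cvgr_lt _ cv _ e0; exists n; apply: hn => /=.
Qed.

(** * The limit of the excesses over a high threshold *)

Section excess_limit.
Context (R : realType) (f psi H : R -> R) (C : set R).
Context (sf : unbounded_survival f) (psi_gt0 : forall t : R, 0 < psi t).
Context (sH : excess_survival H).
Context (H_nondeg : forall e : R, ~ ((forall z, z < e -> H z = 1) /\ H e = 0)).
Context (C_dense : forall x y : R, x < y -> exists2 z, x < z < y & C z).
Context (fH : forall x : R, 0 < x -> C x ->
  f (t + psi t * x) / f t @[t --> +oo] --> H x).

Let f_ni : {homo f : x y / x <= y >-> y <= x}. Proof. by case: sf. Qed.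
Let f_gt0 x : 0 < f x. Proof. by case: sf. Qed.
Let H_ni : {homo H : x y / x <= y >-> y <= x}. Proof. by case: sH. Qed.
Let H_ge0 x : 0 <= H x. Proof. by have [_ /(_ x)/andP[]] := sH. Qed.
Let H_le1 x : H x <= 1. Proof. by have [_ /(_ x)/andP[]] := sH. Qed.
Let H_rc x e : 0 < e -> exists2 y, x < y & H x - e < H y.
Proof. by have [_ _ h _ _] := sH; exact: h. Qed.
Let H_y0 e : 0 < e -> exists x, H x < e.
Proof. by have [_ _ _ h _] := sH; exact: h. Qed.
Let H_neg x : x < 0 -> H x = 1.
Proof. by have [_ _ _ _ h] := sH; exact: h. Qed.

Lemma excess_shift_cvg x : 0 < x -> (t + psi t * x) @[t --> +oo] --> +oo.
Proof.
move=> x0; apply/cvgryPge => A; near=> t.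
have : A <= t by near: t; apply: nbhs_pinfty_ge; exact: num_real.
by move/le_trans; apply; rewrite lerDl mulr_ge0// ltW.
Unshelve. all: by end_near. Qed.

(** The level [t + psi t * x] is again a high threshold, so that exceeding it
    and then exceeding it by [z] more of its own scale decouples in the limit. *)
Lemma iterated_excess_cvg x z : 0 < x -> C x -> 0 < z -> C z ->
  f (t + psi t * x + psi (t + psi t * x) * z) / f t @[t --> +oo]
    --> H x * H z.
Proof.
move=> x0 Cx z0 Cz.
have h := cvg_comp _ _ (excess_shift_cvg x0) (fH z0 Cz).
rewrite (_ : (fun t => _) = (fun t => f (t + psi t * x) / f t) \*
  ((fun t => f (t + psi t * z) / f t) \o (fun t => t + psi t * x))).
  exact: cvgM (fH x0 Cx) h.
apply/funext => t /=.
by rewrite [RHS]mulrC mulrA divfK// gt_eqF.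
Qed.

(** The excesses over [t + psi t * x] can be measured at the scale of [t] or at
    the scale of the new threshold. Both tail quotients converge, and comparing
    their limits compares the two scales. *)
Lemma scale_ratio_lt x z w : 0 < x -> C x -> 0 < z -> C z -> 0 < w -> C (x + w) ->
  H (x + w) < H x * H z ->
  \forall t \near +oo, psi (t + psi t * x) * z < psi t * w.
Proof.
move=> x0 Cx z0 Cz w0 Cw lt.
have /cvgB /(_ (fH (addr_gt0 x0 w0) Cw)) cv := iterated_excess_cvg x0 Cx z0 Cz.
have : 0 < H x * H z - H (x + w) by rewrite subr_gt0.
move/(cvgr_gt _ cv) => ev; near=> t.
have : 0 < f (t + psi t * x + psi (t + psi t * x) * z) / f t
           - f (t + psi t * (x + w)) / f t.
  by near: t; apply: ev.
rewrite subr_gt0 ltr_pM2r ?invr_gt0// => /(nonincreasing_lt_arg f_ni).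
by rewrite mulrDr addrA ltrD2l.
Unshelve. all: by end_near. Qed.

Lemma scale_ratio_gt x z w : 0 < x -> C x -> 0 < z -> C z -> 0 < w -> C (x + w) ->
  H x * H z < H (x + w) ->
  \forall t \near +oo, psi t * w < psi (t + psi t * x) * z.
Proof.
move=> x0 Cx z0 Cz w0 Cw lt.
have /cvgB /(_ (fH (addr_gt0 x0 w0) Cw)) cv := iterated_excess_cvg x0 Cx z0 Cz.
have : H x * H z - H (x + w) < 0 by rewrite subr_lt0.
move/(cvgr_lt _ cv) => ev; near=> t.
have : f (t + psi t * x + psi (t + psi t * x) * z) / f t
           - f (t + psi t * (x + w)) / f t < 0.
  by near: t; apply: ev.
rewrite subr_lt0 ltr_pM2r ?invr_gt0// => /(nonincreasing_lt_arg f_ni).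
by rewrite mulrDr addrA ltrD2l.
Unshelve. all: by end_near. Qed.

Lemma C_dense_shift x u v : u < v -> exists2 w, u < w < v & C (x + w).
Proof.
move=> uv; have [|z /andP[z1 z2] Cz] := @C_dense (x + u) (x + v).
  by rewrite ltrD2l.
by exists (z - x); [rewrite ltrBrDl z1 ltrBlDl|rewrite subrKC].
Qed.

Lemma excess_gt0_dense : exists2 z, 0 < z & C z /\ 0 < H z.
Proof.
suff [z z0 hz] : exists2 z, 0 < z & 0 < H z.
  have [w /andP[w0 wz] Cw] := C_dense z0.
  by exists w => //; split => //; apply: lt_le_trans hz (H_ni (ltW wz)).
apply: contrapT => h.
have hz z : 0 < z -> H z = 0.
  move=> z0; apply/eqP; rewrite eq_le H_ge0 andbT leNgt; apply/negP => hz.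
  by apply: h; exists z.
apply: (H_nondeg (e := 0)); split; first exact: H_neg.
apply/eqP; rewrite eq_le H_ge0 andbT leNgt; apply/negP => h0.
have [y y0] := @H_rc 0 _ h0.
by rewrite subrr hz// ltxx.
Qed.

(** Threshold stability, as in the Pickands-Balkema-de Haan theorem: beyond [x]
    the limit law is a rescaled copy of itself. The scale is the upper limit of
    [psi (t + psi t * x) / psi t], which exists without any compactness argument
    because a frequent, respectively eventual, bound on this quotient turns into
    an inequality between [H] at two points. *)
Lemma excess_stability x : 0 < x -> C x -> 0 < H x ->
  exists2 c, 0 < c & forall z, 0 <= z -> H (x + c * z) = H x * H z.
Proof.
move=> x0 Cx Hx0.
pose rho t := psi (t + psi t * x).
(* the values that the ratio of the two scales exceeds frequently *)
pose S : set R := [set r | 0 < r /\ ~ \forall t \near +oo, rho t < r * psi t].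
have Sdn r r' : S r -> 0 < r' -> r' <= r -> S r'.
  move=> [r0 nr] r'0 r'r; split=> // e; apply: nr; near=> t.
  have /lt_le_trans -> // : rho t < r' * psi t by near: t.
  by rewrite ler_wpM2r// ltW.
have Sa r z w : S r -> 0 < z -> C z -> 0 < w -> C (x + w) -> w <= r * z ->
    H x * H z <= H (x + w).
  move=> [r0 nr] z0 Cz w0 Cw wrz; rewrite leNgt; apply/negP => lt; apply: nr.
  have ev := scale_ratio_lt x0 Cx z0 Cz w0 Cw lt; near=> t.
  rewrite -(ltr_pM2r z0); apply: (@lt_le_trans _ _ (psi t * w)).
    by near: t.
  by rewrite -mulrA mulrCA ler_wpM2l// ltW.
have Sb r z w : ~ S r -> 0 < r -> 0 < z -> C z -> 0 < w -> C (x + w) ->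
    r * z <= w -> H (x + w) <= H x * H z.
  move=> nS r0 z0 Cz w0 Cw rzw; rewrite leNgt; apply/negP => lt.
  apply: nS; split=> // ev2.
  have ev := scale_ratio_gt x0 Cx z0 Cz w0 Cw lt.
  have : \forall t \near pinfty_nbhs R, False.
    near=> t.
    have h1 : psi t * w < rho t * z by near: t.
    have h2 : rho t < r * psi t by near: t.
    move: h1; apply/negP; rewrite -leNgt.
    apply: (@le_trans _ _ (r * psi t * z)); first by rewrite ler_pM2r// ltW.
    by rewrite -mulrA mulrCA ler_wpM2l// ltW.
  by move=> /filter_ex[].
(* otherwise [H x * H z] would be below the limit 0 of [H] at infinity *)
have Sub : exists M, forall r, S r -> r <= M.
  have [z z0 [Cz Hz]] := excess_gt0_dense.
  have [w0 Hw0] := H_y0 (mulr_gt0 Hx0 Hz).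
  pose w1 := Num.max w0 1.
  have [w /andP[w1w _] Cw] := @C_dense_shift x w1 (w1 + 1) ltac:(by rewrite ltrDl).
  have w_gt0 : 0 < w by apply: lt_trans w1w; rewrite lt_max ltr01 orbT.
  exists (w / z) => r Sr; rewrite leNgt; apply/negP => h.
  have := Sa _ _ _ Sr z0 Cz w_gt0 Cw.
  rewrite -ler_pdivrMr// => /(_ (ltW h)).
  apply/negP; rewrite -ltNge; apply: le_lt_trans Hw0; apply: H_ni.
  have : w0 <= w1 by rewrite le_max lexx.
  by move: (ltW w1w) x0; lra.
(* otherwise [H] would jump by the factor [H z < 1] just after [x] *)
have Sne : S !=set0.
  apply/set0P/eqP => S0.
  have nS r : ~ S r by rewrite S0.
  have [z1 Hz1] := H_y0 ltr01.
  pose z2 := Num.max z1 0.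
  have [z /andP[z2z _] Cz] := @C_dense z2 (z2 + 1) ltac:(by rewrite ltrDl).
  have z0 : 0 < z by apply: le_lt_trans z2z; rewrite le_max lexx orbT.
  have Hz : H z < 1.
    apply: le_lt_trans Hz1; apply: H_ni; apply: le_trans (ltW z2z).
    by rewrite le_max lexx.
  have [|y xy Hy] := @H_rc x (H x * (1 - H z)).
    by rewrite mulr_gt0// subr_gt0.
  have [w /andP[w0 wy] Cw] := @C_dense_shift x 0 (y - x) ltac:(by rewrite subr_gt0).
  have := Sb _ _ _ (nS (w / z)) (divr_gt0 w0 z0) z0 Cz w0 Cw.
  rewrite divfK ?gt_eqF// => /(_ (lexx _)).
  apply/negP; rewrite -ltNge.
  have : H y <= H (x + w) by apply: H_ni; rewrite -lerBrDl ltW.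
  by move: Hy; rewrite mulrBr mulr1; lra.
have hS : has_sup S.
  by split => //; case: Sub => M hM; exists M => r /hM.
pose c := sup S.
have c0 : 0 < c.
  case: Sne => r Sr; apply: (@lt_le_trans _ _ r); first by case: Sr.
  by apply: ub_le_sup => //; case: hS.
have cup r : c < r -> ~ S r.
  move=> cr Sr; have : r <= c by apply: ub_le_sup => //; case: hS.
  by rewrite leNgt cr.
have cdn r : 0 < r -> r < c -> S r.
  move=> r0 rc; have [|r' Sr' rr'] := @sup_adherent _ S (c - r) _ hS.
    by rewrite subr_gt0.
  by apply: Sdn Sr' r0 _; move: rr'; rewrite -/c; lra.
(* Inequalities hold at points of [C] only; right-continuity of [H] at
   [x + c * z], then at [z], extends them to all [z]. *)
exists c => // z z_ge0; apply/eqP; rewrite eq_le; apply/andP; split.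
  apply/ler_addgt0Pr => e e0.
  have [y xy Hy] := @H_rc (x + c * z) _ e0.
  have d0 : 0 < y - (x + c * z) by rewrite subr_gt0.
  pose d := y - (x + c * z).
  have [u /andP[zu uz] Cu] := @C_dense z (z + d / (2 * c))
    ltac:(by rewrite ltrDl divr_gt0// mulr_gt0).
  have cu : c * u < c * z + d / 2.
    rewrite -(ltr_pM2l c0) in uz; apply: (lt_le_trans uz).
    rewrite mulrDr lerD2l (_ : c * (d / (2 * c)) = d / 2)//.
    by field; rewrite gt_eqF.
  have [w /andP[cuw wd] Cw] := @C_dense_shift x _ (c * z + d)
    ltac:(apply: (lt_trans cu); rewrite /d; move: d0; lra).
  have u0 : 0 < u by exact: le_lt_trans zu.
  have w0 : 0 < w by apply: lt_trans cuw; rewrite mulr_gt0.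
  have : H (x + w) <= H x * H u.
    apply: (Sb (w / u)) => //; last by rewrite divfK// gt_eqF.
      by apply: cup; rewrite ltr_pdivlMr.
    by rewrite divr_gt0.
  have : H y <= H (x + w) by apply: H_ni; move: wd; rewrite /d; lra.
  have : H x * H u <= H x * H z by rewrite ler_wpM2l// H_ni// ltW.
  by move: Hy; lra.
apply/ler_addgt0Pr => e e0.
have [y zy Hy] := @H_rc z _ e0.
have [u /andP[zu uy] Cu] := C_dense zy.
have u0 : 0 < u by exact: le_lt_trans zu.
have [w /andP[cuw wd] Cw] := @C_dense_shift x (c * z) (c * u)
  ltac:(by rewrite ltr_pM2l).
have w0 : 0 < w by apply: le_lt_trans cuw; rewrite mulr_ge0// ltW.
have h : H x * H u <= H (x + w).
  apply: (Sa (w / u)) => //; last by rewrite divfK// gt_eqF.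
  by apply: cdn; rewrite ?divr_gt0// ltr_pdivrMr.
have h2 : H (x + w) <= H (x + c * z) by apply: H_ni; rewrite lerD2l ltW.
have h3 : H y <= H u by apply: H_ni; exact: ltW.
apply: (@le_trans _ _ (H x * (H y + e))).
  by rewrite ler_wpM2l//; move: Hy; lra.
rewrite mulrDr lerD//.
  by apply: le_trans h2; apply: le_trans h; rewrite ler_wpM2l.
by rewrite ler_piMl// ltW.
Unshelve. all: by end_near. Qed.

(** If [H] were 1 at some [x0 > 0], stability would make [H] invariant under
    [z |-> x0 + c * z]. For [c >= 1] the orbits go to infinity, where [H]
    vanishes; for [c < 1] they go to the fixed point [e], so that [H] is the
    survival function of the Dirac mass at [e]. *)
Lemma excess_lt1 x : 0 < x -> H x < 1.
Proof.
move=> x1_gt0; rewrite ltNge; apply/negP => Hx1.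
have [w /andP[w0 wx] Cw] := C_dense x1_gt0.
have {Hx1} Hw1 : H w = 1.
  by apply/eqP; rewrite eq_le H_le1 (le_trans Hx1)// H_ni// ltW.
move: w w0 wx Cw Hw1 => {}x0 x0_gt0 _ Cx Hx1.
have [|c c0 hc] := excess_stability x0_gt0 Cx; first by rewrite Hx1.
have {}hc z : 0 <= z -> H (x0 + c * z) = H z by move/hc ->; rewrite Hx1 mul1r.
have [c1|c1] := leP 1 c.
  have Hn n : 1 <= H (n.+1%:R * x0).
    elim: n => [|n ih]; first by rewrite mul1r Hx1.
    apply: le_trans ih _; rewrite -hc ?mulr_ge0//; last exact: ltW.
    apply: H_ni; rewrite -natr1 mulrDl mul1r addrC lerD2l ler_peMl//.
    by rewrite mulr_ge0// ltW.
  have [y Hy] := H_y0 ltr01.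
  have := Hn (Num.truncn (y / x0)); apply/negP; rewrite -ltNge.
  apply: le_lt_trans Hy; apply: H_ni; rewrite -ler_pdivrMr//.
  exact/ltW/truncnS_gt.
have c1' : 0 < 1 - c by rewrite subr_gt0.
have [e e0 xe] : exists2 e, 0 < e & x0 = e * (1 - c).
  by exists (x0 / (1 - c)); rewrite ?divr_gt0// divfK// gt_eqF.
have x0e : x0 < e by rewrite xe gtr_pMr//; move: c0; lra.
(* [e] is the fixed point of [z |-> x0 + c * z] *)
have Hn z n : 0 <= z -> H (e + c ^+ n * (z - e)) = H z.
  move=> z0; elim: n => [|n <-]; first by rewrite mul1r subrKC.
  rewrite -[RHS]hc; first by congr H; rewrite xe exprS; ring.
  have cn1 : c ^+ n <= 1 by rewrite exprn_ile1// ltW.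
  have cn0 : 0 <= c ^+ n by rewrite exprn_ge0// ltW.
  rewrite (_ : _ + _ = e * (1 - c ^+ n) + c ^+ n * z); last by ring.
  by rewrite addr_ge0// mulr_ge0// ?subr_ge0//; exact: ltW.
apply: (H_nondeg (e := e)); split=> [z ze|].
  have [z0|z0] := ltP z 0; first exact: H_neg.
  have [||n hn] := @geometric_small R c ((e - z) / (e - x0)).
  - by rewrite c1 ltW.
  - by apply: divr_gt0; rewrite subr_gt0.
  apply/eqP; rewrite eq_le H_le1 -Hx1 -(Hn x0 n (ltW x0_gt0)) H_ni//.
  by move: hn; rewrite ltr_pdivlMr ?subr_gt0//; lra.
apply/eqP; rewrite eq_le H_ge0 andbT leNgt; apply/negP => He.
have [y ey] := H_rc e He; rewrite subrr => Hy.
have [z Hz] := H_y0 Hy.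
have yz := nonincreasing_lt_arg H_ni Hz.
have ez : e < z by apply: lt_trans yz.
have [||n hn] := @geometric_small R c ((y - e) / (z - e)).
- by rewrite c1 ltW.
- by apply: divr_gt0; rewrite subr_gt0.
move: Hz; rewrite -(Hn z n); last by apply: ltW; apply: lt_trans ez.
apply/negP; rewrite -leNgt H_ni//.
by move: hn; rewrite ltr_pdivlMr ?subr_gt0//; lra.
Qed.

Lemma excess_at0 : H 0 = 1.
Proof.
have [x x0 [Cx Hx]] := excess_gt0_dense.
have [c c0 /(_ 0 (lexx _))] := excess_stability x0 Cx Hx.
by rewrite mulr0 addr0 => /eqP; rewrite -{1}[H x]mulr1 => /eqP/(mulfI (lt0r_neq0 Hx)).
Qed.

(** A jump at [y], from [l] down to [H y], is excluded by stability: for [z < y]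
    with [H z] close to [l], the value [H x * H z] of [H] is below [l], hence is
    at most [H y]; now let [x] tend to 0, where [H] is 1. *)
Lemma excess_left_continuous y e : 0 < y -> 0 < e -> exists2 x, 0 < x < y & H x < H y + e.
Proof.
move=> y0 e0; apply: contrapT => h.
have hx x : 0 < x < y -> H y + e <= H x.
  by move=> xy; rewrite leNgt; apply/negP => hx; apply: h; exists x.
pose A := [set H x | x in [set x | 0 < x < y]].
have iA : has_inf A.
  split; first by exists (H (y / 2)), (y / 2) => //=; rewrite divr_gt0//= gtr_pMr//; lra.
  by exists 0 => _ [x _ <-].
pose l := inf A.
have ly : H y + e <= l.
  by apply: lb_le_inf; [case: iA|move=> _ [x xy <-]; exact: hx].
have l0 : 0 < l by apply: lt_le_trans ly; rewrite ltr_wpDl.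
have Al x : 0 < x < y -> l <= H x.
  by move=> xy; apply: ge_inf; [case: iA|exists x].
have key x : 0 < x -> C x -> 0 < H x -> H x * l <= H y.
  move=> x0 Cx Hx; have [c c0 hc] := excess_stability x0 Cx Hx.
  have [|_ [z /andP[z0 zy] <-]] := @inf_adherent _ A (l / H x - l) _ iA.
    by rewrite subr_gt0 ltr_pdivlMr// gtr_pMr// excess_lt1.
  rewrite -/l subrKC ltr_pdivlMr// mulrC -hc; last exact: ltW.
  move=> Hl; apply: (@le_trans _ _ (H x * H z)).
    by rewrite ler_wpM2l// Al// z0 zy.
  rewrite -hc; last exact: ltW.
  apply: H_ni; rewrite leNgt; apply/negP => lt.
  move: Hl; apply/negP; rewrite -leNgt Al// lt andbT.
  by rewrite addr_gt0// mulr_gt0.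
have d0 : 0 < 1 - H y / l by rewrite subr_gt0 ltr_pdivrMr// mul1r; move: ly; lra.
have [v v0] := @H_rc 0 _ d0; rewrite excess_at0 opprB subrKC => Hv.
have [x /andP[x0 xv] Cx] := C_dense v0.
have Hx : H y / l < H x by apply: lt_le_trans Hv _; exact/H_ni/ltW.
have /(key _ x0 Cx) : 0 < H x by apply: le_lt_trans Hx; rewrite divr_ge0// ltW.
by rewrite -ler_pdivlMr// leNgt Hx.
Qed.

(** Both the quotient and the continuous limit are monotone in [x], so convergence
    extends from the dense set [C] to all points. *)
Lemma excess_cvg_everywhere x : 0 < x -> f (t + psi t * x) / f t @[t --> +oo] --> H x.
Proof.
move=> x0; apply/cvgrPdist_lt => e e0.
have [u0 /andP[u00 u0x] Hu0] := excess_left_continuous x0 e0.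
have [v0 xv0 Hv0] := H_rc x e0.
have [u /andP[u0u ux] Cu] := C_dense u0x.
have [v /andP[xv vv0] Cv] := C_dense xv0.
have u_gt0 : 0 < u by exact: lt_trans u0u.
have Hu : H u < H x + e by apply: le_lt_trans Hu0; exact/H_ni/ltW.
have Hv : H x - e < H v by apply: lt_le_trans Hv0 _; exact/H_ni/ltW.
have evu := cvgr_lt _ (fH u_gt0 Cu) _ Hu.
have evv := cvgr_gt _ (fH (lt_trans x0 xv) Cv) _ Hv.
near=> t.
have h1 : f (t + psi t * u) / f t < H x + e by near: t; exact: evu.
have h2 : H x - e < f (t + psi t * v) / f t by near: t; exact: evv.
have h3 : f (t + psi t * x) / f t <= f (t + psi t * u) / f t.
  by rewrite ler_pM2r ?invr_gt0// f_ni// lerD2l ler_wpM2l// ltW.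
have h4 : f (t + psi t * v) / f t <= f (t + psi t * x) / f t.
  by rewrite ler_pM2r ?invr_gt0// f_ni// lerD2l ler_wpM2l// ltW.
by rewrite ltr_norml; apply/andP; split; lra.
Unshelve. all: by end_near. Qed.

Lemma excess_decreasing x y : 0 <= x -> x < y -> 0 < H x -> H y < H x.
Proof.
move=> x0 xy Hx; have [w /andP[xw wy] Cw] := C_dense xy.
have [Hw|Hw] := ltP 0 (H w).
  have w0 : 0 < w by exact: le_lt_trans xw.
  have [c c0 hc] := excess_stability w0 Cw Hw.
  have z0 : 0 < (y - w) / c by rewrite divr_gt0 ?subr_gt0.
  have := hc _ (ltW z0); rewrite mulrC divfK ?gt_eqF// subrKC => ->.
  apply: (@lt_le_trans _ _ (H w)); last exact/H_ni/ltW.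
  by rewrite gtr_pMr// excess_lt1.
by apply: le_lt_trans Hx; apply: le_trans Hw; exact/H_ni/ltW.
Qed.

Lemma excess_onto h : 0 < h < 1 -> exists2 d, 0 < d & H d = h.
Proof.
move=> /andP[h0 h1]; pose A := [set x | h <= H x].
have [M hM] := H_y0 h0.
have uA : has_sup A.
  split; first by exists 0; rewrite /A/= excess_at0 ltW.
  exists M => x Ax; rewrite leNgt; apply/negP => /ltW/H_ni.
  by move/le_lt_trans => /(_ _ hM); rewrite ltNge Ax.
pose d := sup A.
have dub x : A x -> x <= d by move=> Ax; apply: ub_le_sup => //; case: uA.
have d_ge0 : 0 <= d by apply: dub; rewrite /A/= excess_at0 ltW.
have Hdle : H d <= h.
  rewrite leNgt; apply/negP => lt.
  have e0 : 0 < H d - h by rewrite subr_gt0.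
  have [y dy] := H_rc d e0; rewrite opprB subrKC => /ltW/dub.
  by rewrite leNgt dy.
have d0 : 0 < d.
  rewrite lt_neqAle d_ge0 andbT; apply/eqP => d0.
  by move: Hdle; rewrite -d0 excess_at0 leNgt h1.
exists d => //; apply/eqP; rewrite eq_le Hdle/= leNgt; apply/negP => lt.
have e0 : 0 < h - H d by rewrite subr_gt0.
have [x /andP[x0 xd]] := excess_left_continuous d0 e0; rewrite subrKC => Hx.
have [|y Ay] := @sup_adherent _ A (d - x) _ uA.
  by rewrite subr_gt0.
rewrite -/d opprB subrKC => /ltW/H_ni.
by move/le_lt_trans => /(_ _ Hx); rewrite ltNge Ay.
Qed.

End excess_limit.

(** * Generalized inverse of the reciprocal of a survival function *)

Definition inv_tail (R : realType) (f : R -> R) (t : R) : R :=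
  inf [set x | t <= (f x)^-1].

Section inv_tail.
Context (R : realType) (f : R -> R).
Context (sf : unbounded_survival f).
Local Notation U := (inv_tail f).

Let f_ni : {homo f : x y / x <= y >-> y <= x}. Proof. by case: sf. Qed.
Let f_gt0 x : 0 < f x. Proof. by case: sf. Qed.

Lemma inv_tail_has_inf s : 1 < s -> has_inf [set x | s <= (f x)^-1].
Proof.
move=> s1; have s0 : 0 < s by apply: lt_trans s1.
have [_ _ _ f_y f_Ny] := sf; split.
  have [x fx] := f_y s^-1 ltac:(by rewrite invr_gt0).
  by exists x => /=; rewrite -(invrK s) lef_pV2 ?posrE ?invr_gt0// ltW.
have [x fx] := f_Ny s^-1 ltac:(by rewrite invf_lt1).
exists x => y /= sy; rewrite leNgt; apply/negP => /ltW/f_ni.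
apply/negP; rewrite -ltNge; apply: le_lt_trans fx.
by rewrite -(invrK (f y)) lef_pV2 ?posrE ?invr_gt0.
Qed.

Lemma inv_tail_le s x : 1 < s -> f x <= s^-1 -> U s <= x.
Proof.
move=> s1 fx; have s0 : 0 < s by apply: lt_trans s1.
apply: ge_inf; first by case: (inv_tail_has_inf s1).
by rewrite /= -(invrK s) lef_pV2 ?posrE ?invr_gt0.
Qed.

Lemma gt_inv_tail s x : 1 < s -> x < U s -> s^-1 < f x.
Proof. by move=> s1; apply: contraTT; rewrite -!leNgt; exact: inv_tail_le. Qed.

Lemma inv_tailP s : 1 < s -> f (U s) <= s^-1.
Proof.
move=> s1; have s0 : 0 < s by apply: lt_trans s1.
rewrite leNgt; apply/negP => lt.
have e0 : 0 < f (U s) - s^-1 by rewrite subr_gt0.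
have [_ _ f_rc _ _] := sf.
have [y Uy] := f_rc (U s) _ e0; rewrite opprB subrKC => fy.
have [|z /= sz] := @inf_adherent _ _ (y - U s) _ (inv_tail_has_inf s1).
  by rewrite subr_gt0.
rewrite -/(U s) subrKC => /ltW/f_ni fyz.
have : f z <= s^-1 by rewrite -(invrK (f z)) lef_pV2 ?posrE ?invr_gt0.
by rewrite leNgt (lt_le_trans fy fyz).
Qed.

Lemma lt_inv_tail s x : 1 < s -> s^-1 < f x -> x < U s.
Proof.
move=> s1 h; rewrite ltNge; apply/negP => /f_ni.
by move=> /(lt_le_trans h); rewrite ltNge inv_tailP.
Qed.

Lemma inv_tail_mass_le1 s : 1 < s -> s * f (U s) <= 1.
Proof.
move=> s1; rewrite mulrC -ler_pdivlMr ?(lt_trans _ s1)// mul1r.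
exact: inv_tailP.
Qed.

Lemma inv_tail_cvg : U s @[s --> +oo] --> +oo.
Proof.
apply/cvgryPge => A; near=> s.
have s1 : 1 < s by near: s; apply: nbhs_pinfty_gt; exact: num_real.
have sA : (f A)^-1 < s by near: s; apply: nbhs_pinfty_gt; exact: num_real.
apply/ltW/lt_inv_tail => //.
by rewrite -[f A]invrK ltf_pV2 ?posrE ?invr_gt0// (lt_trans _ s1).
Unshelve. all: by end_near. Qed.

End inv_tail.

(** * From excesses to extreme quantiles *)

Section continuous_excess.
Context (R : realType) (f psi H : R -> R).
Context (sf : unbounded_survival f).
Context (psi_gt0 : forall t, 0 < psi t).
Context (H_ni : {homo H : x y / x <= y >-> y <= x}).
Context (H_dec : forall x y, 0 <= x -> x < y -> 0 < H x -> H y < H x).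
Context (H_reach : forall h, 0 < h < 1 -> exists2 d, 0 < d & H d = h).
Context (fH : forall x : R, 0 < x -> f (t + psi t * x) / f t @[t --> +oo] --> H x).
Local Notation U := (inv_tail f).

Let f_ni : {homo f : x y / x <= y >-> y <= x}. Proof. by case: sf. Qed.
Let f_gt0 x : 0 < f x. Proof. by case: sf. Qed.

(** The tail has asymptotically negligible jumps. Take a threshold [u] just
    below the quantile, with [f u] so close to the infimum of [f] below the
    quantile that the step [psi u * d], which divides the tail by a factor
    bounded away from 1, must jump over the quantile; a small [d] makes this
    factor close to 1. *)
Lemma inv_tail_atomless : t * f (U t) @[t --> +oo] --> (1 : R).
Proof.
apply: (@cvg_between _ _ _ _ _ _ 1) => // x /andP[]; last first.
  move=> x1 _; near=> t.
  have t1 : 1 < t by near: t; apply: nbhs_pinfty_gt; exact: num_real.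
  exact: le_trans (inv_tail_mass_le1 sf t1) (ltW x1).
rewrite subrr => x0 x1.
have [|d d0 Hd] := @H_reach ((1 + x) / 2); first by apply/andP; split; lra.
(* [h'] is any number between [H d] and 1 *)
pose h' := (3 + x) / 4.
have ev1 := cvgr_lt _ (fH d0) h' ltac:(rewrite Hd /h'; lra).
have ev2 := cvgr_gt _ (fH d0) x ltac:(rewrite Hd; lra).
have h'0 : 0 < h' by rewrite /h'; lra.
have h'1 : h' < 1 by rewrite /h'; lra.
have [M [_ hM]] := filterI ev1 ev2.
near=> s.
have s1 : 1 < s by near: s; apply: nbhs_pinfty_gt; exact: num_real.
have s0 : 0 < s by apply: lt_trans s1.
have UM : M + 1 < U s.
  by near: s; apply: (cvgryPgt _).1 (inv_tail_cvg sf) (M + 1).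
pose A := [set f u | u in [set u | M < u < U s]].
have iA : has_inf A.
  split; first by exists (f (M + 1)), (M + 1) => //=; rewrite UM ltrDl ltr01.
  by exists 0 => _ [u _ <-]; exact: ltW.
have Age : s^-1 <= inf A.
  apply: lb_le_inf; first by case: iA.
  by move=> _ [u /andP[_ uU] <-]; apply/ltW/(gt_inv_tail sf).
have A0 : 0 < inf A by apply: lt_le_trans Age; rewrite invr_gt0.
have [|_ [u /andP[Mu uU] <-]] := @inf_adherent _ A (inf A / h' - inf A) _ iA.
  by rewrite subr_gt0 ltr_pdivlMr// gtr_pMr.
rewrite subrKC ltr_pdivlMr// mulrC => fu.
have [] := hM _ Mu; rewrite ltr_pdivrMr// ltr_pdivlMr// => fu1 fu2.
have Us : U s <= u + psi u * d.
  rewrite leNgt; apply/negP => lt.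
  have : inf A <= f (u + psi u * d).
    apply: ge_inf; first by case: iA.
    exists (u + psi u * d) => //=; rewrite lt andbT (lt_trans Mu)// ltrDl.
    by rewrite mulr_gt0.
  by rewrite leNgt (lt_trans fu1).
rewrite mulrC -ler_pdivrMr//.
apply: le_trans (f_ni Us); apply: le_trans (ltW fu2).
by rewrite ler_wpM2l ?(ltW x0)//; apply/ltW/(gt_inv_tail sf).
Unshelve. all: by end_near. Qed.

Lemma tail_at_quantile x : 0 < x ->
  t * f (U t + psi (U t) * x) @[t --> +oo] --> H x.
Proof.
move=> x0; rewrite -(mul1r (H x)).
apply: (cvg_ext (cvgM inv_tail_atomless
  (cvg_comp _ _ (inv_tail_cvg sf) (fH x0)))) => t /=.
by rewrite -[RHS]mulrA; congr (_ * _); rewrite [RHS]mulrC divfK// gt_eqF.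
Qed.

(** A quantile function of the excess limit, indexed by the reciprocal of the
    tail probability. *)
Definition excess_quantile (s : R) : R := get [set d | 0 < d /\ H d = s^-1].
Local Notation D := excess_quantile.

Lemma excess_quantileP s : 1 < s -> 0 < D s /\ H (D s) = s^-1.
Proof.
move=> s1; have s0 : 0 < s by apply: lt_trans s1.
rewrite /D; apply: (@getPex _ [set d | 0 < d /\ H d = s^-1]).
have [|d d0 Hd] := @H_reach s^-1; last by exists d.
by rewrite invr_gt0 s0 invf_lt1.
Qed.

Definition quantile_quot (s t : R) := (U (s * t) - U t) / psi (U t).

Lemma quantile_quot_cvg s : 1 < s ->
  quantile_quot s t @[t --> +oo] --> D s.
Proof.
move=> s1; have s0 : 0 < s by apply: lt_trans s1.
have [D0 HD] := excess_quantileP s1.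
have H0 : 0 < H (D s) by rewrite HD invr_gt0.
apply: (@cvg_between _ _ _ _ _ _ (D s)) => // x /andP[].
  rewrite subrr => x0 xD.
  have Hx : s^-1 < H x.
    rewrite -HD; apply: H_dec => //; first exact: ltW.
    exact: lt_le_trans H0 (H_ni (ltW xD)).
  have ev := cvgr_gt _ (tail_at_quantile x0) _ Hx.
  near=> t.
  have t1 : 1 < t by near: t; apply: nbhs_pinfty_gt; exact: num_real.
  have t0 : 0 < t by apply: lt_trans t1.
  have st1 : 1 < s * t by rewrite -[1]mulr1 ltr_pM.
  rewrite /quantile_quot ler_pdivlMr// lerBrDl [x * _]mulrC.
  apply/ltW/(lt_inv_tail sf) => //.
  by rewrite invfM ltr_pdivrMr// [ltRHS]mulrC; near: t; exact: ev.
move=> Dx _; have x0 : 0 < x by exact: lt_trans Dx.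
have Hx : H x < s^-1 by rewrite -HD; apply: H_dec => //; exact: ltW.
have ev := cvgr_lt _ (tail_at_quantile x0) _ Hx.
near=> t.
have t1 : 1 < t by near: t; apply: nbhs_pinfty_gt; exact: num_real.
have t0 : 0 < t by apply: lt_trans t1.
have st1 : 1 < s * t by rewrite -[1]mulr1 ltr_pM.
rewrite /quantile_quot ler_pdivrMr// lerBlDl [x * _]mulrC.
apply: (inv_tail_le sf) => //; apply: ltW.
by rewrite invfM ltr_pdivlMr// [ltLHS]mulrC; near: t; exact: ev.
Unshelve. all: by end_near. Qed.

Lemma excess_quantile_lt s s' : 1 < s -> s < s' -> D s < D s'.
Proof.
move=> s1 ss'; have s0 : 0 < s by apply: lt_trans s1.
have s'1 : 1 < s' by apply: lt_trans ss'.
rewrite ltNge; apply/negP => /H_ni.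
rewrite (excess_quantileP s1).2 (excess_quantileP s'1).2 leNgt => /negP; apply.
by rewrite ltf_pV2 ?posrE// (lt_trans s0).
Qed.

(** The increment of quantiles from [s * t] to [r * s * t] is seen at the scale
    of [t] or at the scale of [s * t]. *)
Lemma quantile_quotM s r t :
  quantile_quot (r * s) t - quantile_quot s t =
  quantile_quot r (s * t) * (psi (U (s * t)) / psi (U t)).
Proof.
rewrite /quantile_quot mulrA mulrA -mulrBl opprB addrA subrK.
by rewrite divfK// gt_eqF.
Qed.

(** By [quantile_quotM] the ratio of scales is a quotient of two convergent
    quantities, the second of which has a positive limit. *)
Lemma psi_ratio_cvg s : 0 < s -> exists2 k : R, 0 < k &
  psi (U (s * t)) / psi (U t) @[t --> +oo] --> k.
Proof.
suff gt1 (u : R) : 1 < u -> exists2 k : R, 0 < k &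
    psi (U (u * t)) / psi (U t) @[t --> +oo] --> k.
  move=> s0; have [s1|s1|->] := ltgtP s 1; last 2 first.
  - exact: gt1.
  - exists 1 => //; rewrite (_ : (fun t => _) = cst 1); first exact: cvg_cst.
    by apply/funext => t /=; rewrite mul1r divff// gt_eqF.
  have [|k k0 hk] := gt1 s^-1; first by rewrite invf_gt1.
  exists k^-1; first by rewrite invr_gt0.
  apply: (cvg_ext (cvgV (lt0r_neq0 k0)
    (cvg_comp _ _ (cvg_scale_pinfty s0) hk))) => t /=.
  by rewrite invf_div mulKf// gt_eqF.
move=> u1; have u0 : 0 < u by apply: lt_trans u1.
(* 2 stands for any number above 1 *)
have two1 : 1 < 2 :> R by lra.
have u2 : 1 < 2 * u by lra.
have [D20 _] := excess_quantileP two1.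
exists ((D (2 * u) - D u) / D 2).
  by rewrite divr_gt0// subr_gt0 excess_quantile_lt//; lra.
have cv2 := cvg_comp _ _ (cvg_scale_pinfty u0) (quantile_quot_cvg two1).
apply: (cvg_near_ext (cvgM (cvgB (quantile_quot_cvg u2) (quantile_quot_cvg u1))
  (cvgV (lt0r_neq0 D20) cv2))).
near=> t => /=.
have q0 : 0 < quantile_quot 2 (u * t).
  by near: t; exact: cvgr_gt _ cv2 _ D20.
rewrite -[LHS]/((quantile_quot (2 * u) t - quantile_quot u t)
  * (quantile_quot 2 (u * t))^-1) quantile_quotM mulrAC divff ?mul1r//.
by rewrite gt_eqF.
Unshelve. all: by end_near. Qed.

(** Excesses only see the levels [s >= 1]; a level [s < 1] is reached by looking
    at [t] from the threshold at [s * t], at the cost of a change of scale. *)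
Lemma quantile_limit : exists E : R -> R,
  (forall s : R, 0 < s -> quantile_quot s t @[t --> +oo] --> E s) /\
  {in Num.pos &, {homo E : s r / s < r}}.
Proof.
have ex s : 0 < s -> exists e : R, quantile_quot s t @[t --> +oo] --> e.
  move=> s0; have [s1|s1|->] := ltgtP s 1; last 2 first.
  - by exists (D s); exact: quantile_quot_cvg.
  - exists 0; rewrite (_ : (fun t => _) = cst 0); first exact: cvg_cst.
    by apply/funext => t /=; rewrite /quantile_quot mul1r subrr mul0r.
  have [k k0 hk] := psi_ratio_cvg s0.
  have s1' : 1 < s^-1 by rewrite invf_gt1.
  have cv := cvg_comp _ _ (cvg_scale_pinfty s0) (quantile_quot_cvg s1').
  exists (- (D s^-1 * k)).
  apply: (cvg_ext (cvgN (cvgM cv hk))) => t /=.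
  rewrite -[RHS]/(- (quantile_quot s^-1 (s * t) * _)) -quantile_quotM mulVf ?gt_eqF//.
  rewrite opprB [quantile_quot 1 t](_ : _ = 0) ?subr0//.
  by rewrite /quantile_quot mul1r subrr mul0r.
pose E s := get [set e : R | quantile_quot s t @[t --> +oo] --> e].
have EP s : 0 < s -> quantile_quot s t @[t --> +oo] --> E s.
  move=> s0; have [e he] := ex s s0.
  by apply: (@getPex _ [set e : R | quantile_quot s t @[t --> +oo] --> e]); exists e.
exists E; split => // s r s0 r0 sr.
have s0' : 0 < s by [].
have rs1 : 1 < r / s by rewrite ltr_pdivlMr// mul1r.
have [k k0 hk] := psi_ratio_cvg s0'.
have cv := cvg_comp _ _ (cvg_scale_pinfty s0') (quantile_quot_cvg rs1).
have cvk : (quantile_quot r t - quantile_quot s t) @[t --> +oo] --> D (r / s) * k.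
  apply: (cvg_ext (cvgM cv hk)) => t /=.
  by rewrite -[in LHS](divfK (lt0r_neq0 s0') r) quantile_quotM.
have cv' : (quantile_quot r t - quantile_quot s t) @[t --> +oo] --> E r - E s.
  exact: cvgB (EP r r0) (EP s s0).
have lE : E r - E s = D (r / s) * k by exact: cvg_unique cv' cvk.
by rewrite -subr_gt0 lE mulr_gt0// (excess_quantileP rs1).1.
Qed.

Lemma tail_quantile_limit (E : R -> R) :
  (forall s : R, 0 < s -> quantile_quot s t @[t --> +oo] --> E s) ->
  {in Num.pos &, {homo E : s r / s < r}} ->
  forall s, 0 < s -> t * f (U t + psi (U t) * E s) @[t --> +oo] --> s^-1.
Proof.
move=> EP Elt s s0.
apply: (@cvg_between _ _ _ _ _ _ s^-1); rewrite ?invr_gt0// => x /andP[].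
  rewrite subrr => x0 xs.
  have lt : s < x^-1 by rewrite -[s]invrK ltf_pV2 ?posrE ?invr_gt0.
  have x'0 : 0 < x^-1 by rewrite invr_gt0.
  have ev := cvgr_gt _ (EP _ x'0) _ (Elt _ _ s0 x'0 lt).
  near=> t.
  have t1 : 1 < t by near: t; apply: nbhs_pinfty_gt; exact: num_real.
  have t0 : 0 < t by apply: lt_trans t1.
  have st1 : 1 < x^-1 * t.
    rewrite mulrC ltr_pdivlMr// mul1r.
    by near: t; apply: nbhs_pinfty_gt; exact: num_real.
  have : E s < quantile_quot x^-1 t by near: t; exact: ev.
  rewrite /quantile_quot ltr_pdivlMr// ltrBrDl [E s * _]mulrC => /(gt_inv_tail sf st1).
  by rewrite invfM invrK ltr_pdivrMr// [ltRHS]mulrC => /ltW.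
move=> sx _; have x0 : 0 < x by apply: lt_trans sx; rewrite invr_gt0.
have lt : x^-1 < s by rewrite -[s]invrK ltf_pV2 ?posrE ?invr_gt0.
have x'0 : 0 < x^-1 by rewrite invr_gt0.
have ev := cvgr_lt _ (EP _ x'0) _ (Elt _ _ x'0 s0 lt).
near=> t.
have t1 : 1 < t by near: t; apply: nbhs_pinfty_gt; exact: num_real.
have t0 : 0 < t by apply: lt_trans t1.
have st1 : 1 < x^-1 * t.
  rewrite mulrC ltr_pdivlMr// mul1r.
  by near: t; apply: nbhs_pinfty_gt; exact: num_real.
have : quantile_quot x^-1 t < E s by near: t; exact: ev.
rewrite /quantile_quot ltr_pdivrMr// ltrBlDl [E s * _]mulrC => /ltW/f_ni/le_trans.
move=> /(_ _ (inv_tailP sf st1)).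
by rewrite invfM invrK ler_pdivlMr// [leLHS]mulrC.
Unshelve. all: by end_near. Qed.

End continuous_excess.

(** * The law with prescribed extreme quantiles *)

Lemma uniform_itv (R : realType) (p q : R) : 0 <= p -> p <= q -> q <= 1 ->
  uniform_prob (@ltr01 R) `]p, q[ = (q - p)%:E.
Proof.
move=> p0 pq q1; rewrite /uniform_prob (eq_integral (fun=> 1%E)); last first.
  move=> x; rewrite inE/= in_itv/= => /andP[px xq].
  rewrite /uniform_pdf (le_trans p0 (ltW px)) (le_trans (ltW xq) q1)/=.
  by rewrite subr0 invr1.
rewrite integral_cst//= mul1e.
rewrite lebesgue_measure_itv/= lte_fin.
by move: pq; rewrite le_eqVlt => /predU1P[->|->]//; rewrite ltxx subrr.
Qed.

(** The law of [E xi] for a unit Frechet variable [xi], whose distribution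
    function is [expR (- s^-1)]. Two inequalities are needed as [E] may jump
    over [z]. *)
Definition quantile_law (R : realType) (E : R -> R) (mu : probability R R) :=
  forall s z : R, 0 < s ->
    (E s <= z -> ((expR (- s^-1))%:E <= mu `]-oo, z]%classic)%E) /\
    (z <= E s -> (mu `]-oo, z]%classic <= (expR (- s^-1))%:E)%E).

(** The law is the image of the uniform law on the unit interval under
    [u |-> E ((- ln u)^-1)], which is monotone and hence measurable. *)
Lemma quantile_law_exists (R : realType) (E : R -> R) :
  {in Num.pos &, {homo E : s r / s < r}} ->
  exists mu : probability R R, quantile_law E mu.
Proof.
move=> Elt; pose sc (u : R) := (- ln u)^-1.
have sc0 u : 0 < u < 1 -> 0 < sc u.
  by move=> u01; rewrite invr_gt0 oppr_gt0 ln_lt0.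
have sclt u v : 0 < u < 1 -> 0 < v < 1 -> u < v -> sc u < sc v.
  move=> u01 v01 uv; rewrite /sc ltf_pV2 ?posrE ?oppr_gt0 ?ln_lt0//.
  rewrite ltrN2 ltr_ln ?posrE//; first by case/andP: u01.
  by case/andP: v01.
have Ele u v : 0 < u < 1 -> 0 < v < 1 -> u <= v -> E (sc u) <= E (sc v).
  move=> u01 v01; rewrite le_eqVlt => /predU1P[->//|uv].
  by apply/ltW/Elt; [exact: sc0|exact: sc0|exact: sclt].
(* [sc] maps the uniform law to the unit Frechet law *)
have mh : measurable_fun setT
    ((E \o sc) \_ `]0, 1[%classic : measurableTypeR R -> R).
  apply/(measurable_restrictT (E \o sc) (measurable_itv `]0, 1[)).
  apply: (measurability (@RGenCInfty.G R)) => [|/= _ [_] [r] -> <-].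
    exact: RGenCInfty.measurableE.
  apply: is_interval_measurable => s t/=.
  rewrite !in_itv/= !andbT => -[s01 rs] [t01 rt] u /andP[su ut].
  have u01 : 0 < u < 1.
    move: s01 t01 => /andP[s0 _] /andP[_ t1].
    by rewrite (lt_le_trans s0)//= (le_lt_trans ut).
  split => /=; first by rewrite in_itv.
  by rewrite in_itv/= andbT; apply: le_trans rs _; exact: Ele.
pose h : {RV uniform_prob (@ltr01 R) >-> R} :=
  @mfun_Sub _ _ (measurableTypeR R) R _ (mem_set mh).
have hE u : 0 < u < 1 -> h u = E (sc u).
  by move=> u01; rewrite /h/= patchE ifT// inE/= in_itv.
exists (distribution (uniform_prob (@ltr01 R)) h) => s z s0.
have p0 : 0 < expR (- s^-1) by exact: expR_gt0.
have p1 : expR (- s^-1) < 1 by rewrite expR_lt1 oppr_lt0 invr_gt0.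
have scp : sc (expR (- s^-1)) = s by rewrite /sc expRK opprK invrK.
have mph (A : set R) : measurable A -> measurable (h @^-1` A).
  by move=> mA; rewrite -[X in measurable X]setTI; exact: measurable_funPT.
split=> hz; rewrite /distribution /pushforward.
- rewrite -[leLHS](_ : uniform_prob (@ltr01 R) `]0, expR (- s^-1)[ = _); last first.
    by rewrite uniform_itv ?subr0// ltW.
  apply: le_measure; rewrite ?inE//; first exact: mph.
  move=> u /=; rewrite !in_itv/= => /andP[u0 up].
  have u01 : 0 < u < 1 by rewrite u0 (lt_trans up).
  have /= -> := hE _ u01; apply: le_trans hz; rewrite -scp.
  apply: Ele => //; last exact: ltW.
  by rewrite p0.
- pose A := `]expR (- s^-1), 1[%classic.
  have -> : (expR (- s^-1))%:E = (1 - uniform_prob (@ltr01 R) A)%E.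
    by rewrite /A uniform_itv ?(ltW p0) ?(ltW p1)//= -EFinD opprB subrKC.
  rewrite leeBrDr; last by rewrite fin_num_measure//; exact: measurable_itv.
  have mhz := mph _ (measurable_itv `]-oo, z]).
  have mU := measurableU _ _ mhz (measurable_itv `]expR (- s^-1), 1[).
  apply: le_trans (probability_le1 (uniform_prob (@ltr01 R)) mU).
  rewrite measureU//.
  rewrite -subset0 => u /=; rewrite !in_itv/= => -[+ /andP[pu u1]].
  have u01 : 0 < u < 1 by rewrite (lt_trans p0 pu).
  have /= -> := hE _ u01; rewrite leNgt => /negP; apply.
  apply: le_lt_trans hz _; rewrite -[s]scp; apply: Elt; rewrite ?scp//.
    exact: sc0.
  by rewrite -[s]scp sclt// p0.
Qed.

Section quantile_law.
Context (R : realType) (E : R -> R) (mu : probability R R).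
Context (Emu : quantile_law E mu).

Lemma quantile_law_nondegenerate c : mu [set c] <> 1%E.
Proof.
move=> h; have [lo up] := @Emu 1 c ltr01.
have p1 : expR (- 1^-1) < 1 :> R by rewrite expR_lt1 invr1 oppr_lt0.
have p0 : 0 < expR (- 1^-1) :> R by exact: expR_gt0.
have [cE|Ec] := leP c (E 1).
  have : (mu [set c] <= mu `]-oo, c]%classic)%E.
    by apply: le_measure; rewrite ?inE// => x /= ->; rewrite in_itv/=.
  rewrite h => /le_trans/(_ (up cE)).
  by rewrite lee_fin leNgt p1.
have [lo1 _] := @Emu 1 (E 1) ltr01.
have hU : (mu (`]-oo, E 1%R]%classic `|` [set c]) =
    mu `]-oo, E 1%R]%classic + mu [set c])%E.
  apply: measureU => //; rewrite -subset0 => x /= [].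
  by rewrite in_itv/= => + xc; rewrite xc leNgt Ec.
have : (mu (`]-oo, E 1%R]%classic `|` [set c]) <= 1)%E.
  by apply: probability_le1; exact: measurableU.
rewrite hU h => H; have := le_trans (leeD2r 1 (lo1 (lexx _))) H.
by rewrite -EFinD lee_fin gerDr leNgt p0.
Qed.

Context (I : Type) (F : set_system I) (FF : Filter F).
Context (f : R -> R) (N b a : I -> R).
Context (f_ni : {homo f : x y / x <= y >-> y <= x}).
Context (f_ge0 : forall x, 0 <= f x).
Context (N_ge0 : forall n, 0 <= N n).
Context (a_ge0 : forall n, 0 <= a n).
Context (fE : forall s, 0 < s -> N n * f (b n + a n * E s) @[n --> F] --> s^-1).
Let g z := fine (mu `]-oo, z]%classic).

Let gE z : mu `]-oo, z]%classic = (g z)%:E.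
Proof. by rewrite /g fineK// fin_num_measure. Qed.

Lemma intensity_ge s z e : 0 < s -> z <= E s -> e < s^-1 ->
  \forall n \near F, e < N n * f (b n + a n * z).
Proof.
move=> s0 zE es; have ev := cvgr_gt _ (fE s0) _ es.
near=> n; apply: (@lt_le_trans _ _ (N n * f (b n + a n * E s))).
  by near: n; exact: ev.
by rewrite ler_wpM2l// f_ni// lerD2l ler_wpM2l.
Unshelve. all: by end_near. Qed.

Lemma intensity_le s z e : 0 < s -> E s <= z -> s^-1 < e ->
  \forall n \near F, N n * f (b n + a n * z) < e.
Proof.
move=> s0 zE es; have ev := cvgr_lt _ (fE s0) _ es.
near=> n; apply: (@le_lt_trans _ _ (N n * f (b n + a n * E s))).
  by rewrite ler_wpM2l// f_ni// lerD2l ler_wpM2l.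
by near: n; exact: ev.
Unshelve. all: by end_near. Qed.

(** The law of [E xi] is the limit law of maxima: the expected number [N n * f]
    of exceedances of a normalized level [z] is monotone in [z] and known at the
    levels [E s], among which those below and above [z] decide. *)
Lemma intensity_cvg z : 0 < g z ->
  N n * f (b n + a n * z) @[n --> F] --> - ln (g z).
Proof.
move=> g0.
have g1 : g z <= 1 by rewrite -lee_fin -gE probability_le1.
have lg0 : 0 <= - ln (g z) by rewrite oppr_ge0 ln_le0.
have expg e : expR (ln (g z) + e) = g z * expR e by rewrite expRD lnK.
apply/cvgrPdist_lt => e e0.
have up : \forall n \near F, N n * f (b n + a n * z) < - ln (g z) + e.
  pose s := (- ln (g z) + e / 2)^-1.
  have s0 : 0 < s by rewrite invr_gt0; lra.
  have [zE|Ez] := leP z (E s); last first.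
    by apply: (intensity_le s0 (ltW Ez)); rewrite /s invrK; lra.
  have [_ /(_ zE)] := @Emu s z s0.
  rewrite gE lee_fin /s invrK opprD opprK expg leNgt => /negP[].
  by rewrite gtr_pMr// expR_lt1; lra.
(* when the lower bound is negative, there may be no level [s] to compare to *)
have lo : \forall n \near F, - ln (g z) - e < N n * f (b n + a n * z).
  have [le0|gt0] := leP (- ln (g z) - e / 2) 0.
    near=> n; apply: (@lt_le_trans _ _ 0); first lra.
    by rewrite mulr_ge0.
  pose s := (- ln (g z) - e / 2)^-1.
  have s0 : 0 < s by rewrite invr_gt0.
  have [zE|Ez] := leP z (E s).
    by apply: (intensity_ge s0 zE); rewrite /s invrK; lra.
  have [/(_ (ltW Ez)) + _] := @Emu s z s0.
  rewrite gE lee_fin /s invrK opprB opprK addrC expg leNgt => /negP[].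
  by rewrite ltr_pMr// expR_gt1; lra.
near=> n.
have : N n * f (b n + a n * z) < - ln (g z) + e by near: n.
have : - ln (g z) - e < N n * f (b n + a n * z) by near: n.
by rewrite ltr_norml => ? ?; apply/andP; split; lra.
Unshelve. all: by end_near. Qed.

(** When the law gives no mass to the half-line up to [z], all levels [E s] are
    above [z]. *)
Lemma intensity_pinfty z : g z = 0 ->
  N n * f (b n + a n * z) @[n --> F] --> +oo.
Proof.
move=> g0; apply/cvgryPgt => A.
pose s := (Num.max A 0 + 1)^-1.
have m0 : 0 <= Num.max A 0 by rewrite le_max lexx orbT.
have s0 : 0 < s by rewrite invr_gt0; lra.
have [zE|Ez] := leP z (E s).
  apply: (intensity_ge s0 zE); rewrite /s invrK.
  by rewrite (@le_lt_trans _ _ (Num.max A 0)) ?le_max ?lexx// ltrDl.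
have [/(_ (ltW Ez)) + _] := @Emu s z s0.
by rewrite gE g0 lee_fin leNgt expR_gt0.
Qed.

End quantile_law.

(** * Monotone functions, survival functions and joint laws *)

Lemma nondecreasing_left_lim (R : realType) (F : R -> R) (x : R) :
  {homo F : x y / x <= y} -> cvg (F y @[y --> x^'-]) /\ lim (F y @[y --> x^'-]) <= F x.
Proof.
move=> ndF; have cl : cvg (F y @[y --> x^'-]).
  apply: nondecreasing_at_left_is_cvgr; near=> z; first by move=> *; exact: ndF.
  by exists (F x) => _ [y /= + <-]; rewrite in_itv/= => /andP[_ /ltW/ndF].
split=> //; apply: limr_le => //; near=> z; apply: ndF.
by near: z; exact: nbhs_left_le.
Unshelve. all: by end_near. Qed.

Lemma nondecreasing_right_lim (R : realType) (F : R -> R) (x : R) :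
  {homo F : x y / x <= y} -> cvg (F y @[y --> x^'+]) /\ F x <= lim (F y @[y --> x^'+]).
Proof.
move=> ndF; have cl : cvg (F y @[y --> x^'+]).
  apply: nondecreasing_at_right_is_cvgr; near=> z; first by move=> *; exact: ndF.
  by exists (F x) => _ [y /= + <-]; rewrite in_itv/= => /andP[/ltW/ndF].
split=> //; apply: limr_ge => //; near=> z; apply: ndF.
by near: z; exact: nbhs_right_ge.
Unshelve. all: by end_near. Qed.

(** Otherwise the whole interval would consist of discontinuities of a monotone
    function, which are countably many, while intervals have positive length. *)
Lemma monotone_continuity_dense (R : realType) (F : R -> R) (a b : R) :
  {homo F : x y / x <= y} -> a < b ->
  exists2 x, a < x < b & {for x, continuous F}.
Proof.
move=> ndF ab; apply: contrapT => h.
have : countable `]a, b[%classic.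
  apply: sub_countable (@discontinuity_countable R a b F _); last first.
    by move=> x y _ _; exact: ndF.
  apply: subset_card_le => x /=; rewrite in_itv/= => xab.
  split=> /=; first by [].
  have [cl ll] := nondecreasing_left_lim x ndF.
  have [cr lr] := nondecreasing_right_lim x ndF.
  split=> //; apply/eqP => e; apply: h; exists x => //.
  have lE : lim (F y @[y --> x^'-]) = F x.
    by apply/eqP; rewrite eq_le ll e lr.
  apply/left_right_continuousP; split.
    by rewrite -[X in _ --> X]lE.
  by rewrite -[X in _ --> X]lE e.
move/countable_lebesgue_measure0; rewrite lebesgue_measure_itv/= lte_fin ab.
by move/eqP; rewrite -EFinB eqe subr_eq0 gt_eqF.
Qed.

Section tail_facts.
Context (R : realType) (d : measure_display) (T : measurableType d).
Context (P : probability T R) (X : {RV P >-> R}).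

Lemma tailE x : tail X x = fine (P [set w | x < X w]).
Proof.
rewrite /tail /ccdf /distribution /pushforward; congr (fine (P _)).
by apply/seteqP; split=> w /=; rewrite in_itv/= andbT.
Qed.

Lemma tail_EFin x : ccdf X x = (tail X x)%:E.
Proof. by rewrite /tail fineK// fin_num_measure. Qed.

Lemma tail_ge0 x : 0 <= tail X x.
Proof. exact: fine_ge0. Qed.

Lemma tail_le1 x : tail X x <= 1.
Proof. by rewrite -lee_fin -tail_EFin probability_le1. Qed.

Lemma tail_ni : {homo tail X : x y / x <= y >-> y <= x}.
Proof. by move=> x y xy; rewrite -lee_fin -!tail_EFin ccdf_nonincreasing. Qed.

Lemma tail_rc x e : 0 < e -> exists2 y, x < y & tail X x - e < tail X y.
Proof.
move=> e0.
have cv : tail X y @[y --> x^'+] --> tail X x.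
  apply: fine_cvg; rewrite -tail_EFin; exact: ccdf_right_continuous.
have lt : tail X x - e < tail X x by rewrite ltrBlDr ltrDl.
have [y [xy ty]] := filter_ex (filterI (nbhs_right_gt x) (cvgr_gt _ cv _ lt)).
by exists y.
Qed.

Lemma tail_y0 e : 0 < e -> exists x, tail X x < e.
Proof.
move=> e0; have cv : tail X y @[y --> +oo] --> (0 : R) by exact/fine_cvg/cvg_ccdfy0.
exact: (filter_ex (cvgr_lt _ cv _ e0)).
Qed.

Lemma tail_Ny1 e : e < 1 -> exists x, e < tail X x.
Proof.
move=> e0; have cv : tail X y @[y --> -oo] --> (1 : R) by exact/fine_cvg/cvg_ccdfNy1.
exact: (filter_ex (cvgr_gt _ cv _ e0)).
Qed.

Lemma tail_unbounded_survival : (forall x, 0 < tail X x) -> unbounded_survival (tail X).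
Proof.
split=> //; [exact: tail_ni|exact: tail_rc|exact: tail_y0|exact: tail_Ny1].
Qed.

End tail_facts.

Section real_probability.
Context (R : realType) (d : measure_display) (T : measurableType d).
Context (P : probability T R).
Local Notation pr A := (fine (P A)).

Lemma prE A : measurable A -> P A = (pr A)%:E.
Proof. by move=> mA; rewrite fineK// fin_num_measure. Qed.

Lemma pr_ge0 A : 0 <= pr A.
Proof. exact: fine_ge0. Qed.

Lemma pr_le1 A : measurable A -> pr A <= 1.
Proof. by move=> mA; rewrite -lee_fin -prE// probability_le1. Qed.

Lemma pr_le A B : measurable A -> measurable B -> A `<=` B -> pr A <= pr B.
Proof.
move=> mA mB AB; rewrite -lee_fin -!prE//.
by apply: le_measure => //; rewrite inE.
Qed.

Lemma pr_splitI A B : measurable A -> measurable B ->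
  pr A = pr (A `&` B) + pr (A `&` ~` B).
Proof.
move=> mA mB; apply: EFin_inj; rewrite EFinD -!prE//; last 2 first.
- by apply: measurableI => //; exact: measurableC.
- exact: measurableI.
by rewrite -setDE addeC -measureDI.
Qed.

Lemma pr_setC A : measurable A -> pr (~` A) = 1 - pr A.
Proof.
move=> mA; apply: EFin_inj; rewrite EFinB -!prE//; last exact: measurableC.
by rewrite probability_setC.
Qed.

Lemma pr_unionE A B : measurable A -> measurable B ->
  pr (A `|` B) = pr A + pr B - pr (A `&` B).
Proof.
move=> mA mB; have mU : measurable (A `|` B) by exact: measurableU.
rewrite (pr_splitI mU mA) (pr_splitI mB mA).
rewrite (_ : (A `|` B) `&` A = A); last first.
  by rewrite setIC setIUr setIid setUidl//; exact: subIsetl.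
rewrite (_ : (A `|` B) `&` ~` A = B `&` ~` A); last first.
  by rewrite setIUl setICr set0U.
by rewrite [A `&` B]setIC; lra.
Qed.

End real_probability.

Section tail_sets.
Context (R : realType) (d : measure_display) (T : measurableType d).
Context (P : probability T R) (Z : {RV P >-> R}).

Lemma measurable_tail_set x : measurable [set w | x < Z w].
Proof.
rewrite (_ : [set w | _] = Z @^-1` `]x, +oo[); last first.
  by apply/seteqP; split=> w /=; rewrite in_itv/= andbT.
by rewrite -[X in measurable X]setTI; exact: measurable_funPT.
Qed.

Lemma measurable_cdf_set x : measurable [set w | Z w <= x].
Proof.
rewrite (_ : [set w | _] = Z @^-1` `]-oo, x]); last first.
  by apply/seteqP; split=> w /=; rewrite in_itv/=.
by rewrite -[X in measurable X]setTI; exact: measurable_funPT.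
Qed.

Lemma setC_tail_set x : ~` [set w | x < Z w] = [set w | Z w <= x].
Proof. by apply/seteqP; split=> w /=; rewrite leNgt => /negP. Qed.

Lemma cdf_tail x : fine (P [set w | Z w <= x]) = 1 - tail Z x.
Proof. by rewrite -setC_tail_set pr_setC ?tailE//; exact: measurable_tail_set. Qed.

Lemma tail_dirac c : (forall z, z < c -> tail Z z = 1) -> tail Z c = 0 ->
  P [set w | Z w = c] = 1%E.
Proof.
move=> lo up.
have mN : measurable (\bigcup_n [set w | Z w <= c - n.+1%:R^-1]).
  by apply: bigcup_measurable => n _; exact: measurable_cdf_set.
have N0 : P (\bigcup_n [set w | Z w <= c - n.+1%:R^-1]) = 0%E.
  apply: measure_negligible => //; apply: negligible_bigcup => n.
  apply/negligibleP; first exact: measurable_cdf_set.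
  apply: (etrans (prE P (measurable_cdf_set (c - n.+1%:R^-1)))).
  by rewrite cdf_tail lo ?subrr// ltrBlDr ltrDl.
have U0 : P [set w | c < Z w] = 0%E.
  by rewrite (prE P (measurable_tail_set c)) -tailE up.
have -> : [set w | Z w = c] =
    ~` ((\bigcup_n [set w | Z w <= c - n.+1%:R^-1]) `|` [set w | c < Z w]).
  apply/seteqP; split=> w /=.
    move=> Zc [[n _ /=]|]; rewrite Zc ?ltxx//.
    by rewrite leNgt ltrBlDr ltrDl invr_gt0 ltr0n.
  move=> /not_orP[h1 /negP]; rewrite -leNgt => h2; apply/eqP.
  rewrite eq_le h2 leNgt/=; apply/negP => lt; apply: h1.
  have c0 : 0 < c - Z w by rewrite subr_gt0.
  exists (Num.truncn (c - Z w)^-1) => //=; rewrite lerBrDr -lerBrDl.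
  by rewrite -[leRHS]invrK lef_pV2 ?posrE ?invr_gt0// ltW// truncnS_gt.
rewrite probability_setC; last first.
  by apply: measurableU => //; exact: measurable_tail_set.
rewrite (_ : P _ = 0%E) ?sube0//; apply/eqP; rewrite eq_le measure_ge0 andbT.
apply: (@le_trans _ _ (P (\bigcup_n [set w | (Z w <= c - n.+1%:R^-1)%R]) +
  P [set w | (c < Z w)%R])%E); last by rewrite N0 U0 adde0.
exact: measureU2 mN (measurable_tail_set c).
Qed.

End tail_sets.

Section margins.
Context (R : realType) (K : probability (R * R)%type R).

Definition fst_rv : {RV K >-> R} := mfun_Sub (mem_set (@measurable_fst _ _ R R)).
Definition snd_rv : {RV K >-> R} := mfun_Sub (mem_set (@measurable_snd _ _ R R)).

Lemma margin1_tail x : margin1 K x = 1 - tail fst_rv x.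
Proof. exact: (cdf_tail fst_rv). Qed.

Lemma margin2_tail x : margin2 K x = 1 - tail snd_rv x.
Proof. exact: (cdf_tail snd_rv). Qed.

Lemma margin1_nd : {homo margin1 K : x y / x <= y}.
Proof. by move=> x y xy; rewrite !margin1_tail lerB// tail_ni. Qed.

Lemma margin2_nd : {homo margin2 K : x y / x <= y}.
Proof. by move=> x y xy; rewrite !margin2_tail lerB// tail_ni. Qed.

Let m1 x : measurable [set u : R * R | u.1 <= x].
Proof. exact: (measurable_cdf_set fst_rv). Qed.

Let m2 x : measurable [set u : R * R | u.2 <= x].
Proof. exact: (measurable_cdf_set snd_rv). Qed.

Let m12 x y : measurable [set u : R * R | u.1 <= x /\ u.2 <= y].
Proof. exact: (measurableI _ _ (m1 x) (m2 y)). Qed.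

Lemma bicdf_le_margin1 x y : bicdf K (x, y) <= margin1 K x.
Proof. by apply: pr_le => // u /= []. Qed.

Lemma margins_le_bicdf x y : margin1 K x + margin2 K y - 1 <= bicdf K (x, y).
Proof.
have := pr_unionE K (m1 x) (m2 y).
have := pr_le1 K (measurableU _ _ (m1 x) (m2 y)).
rewrite -/(margin1 K x) -/(margin2 K y).
rewrite (_ : [set u | _] `&` [set u | _] = [set u | u.1 <= x /\ u.2 <= y])//.
by rewrite -[fine (K [set u | _ /\ _])]/(bicdf K (x, y)); lra.
Qed.

(** The two events differ by strips, whose mass the margins control. *)
Lemma bicdf_modulus x y x' y' : bicdf K (x', y') <=
  bicdf K (x, y) + `|margin1 K x' - margin1 K x| + `|margin2 K y' - margin2 K y|.
Proof.
have key1 a b c : bicdf K (b, c) <= bicdf K (a, c) + `|margin1 K b - margin1 K a|.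
  have [ba|ab] := leP b a.
    apply: ler_wpDr => //; apply: pr_le => // u /= [u1 u2].
    by split=> //; exact: le_trans ba.
  have nd := margin1_nd (ltW ab); rewrite ger0_norm ?subr_ge0//.
  have e1 := pr_splitI K (m12 b c) (m1 a).
  have e2 := pr_splitI K (m1 b) (m1 a).
  have l1 : fine (K ([set u | u.1 <= b /\ u.2 <= c] `&` ~` [set u | u.1 <= a]))
      <= fine (K ([set u | u.1 <= b] `&` ~` [set u | u.1 <= a])).
    apply: pr_le; [| |by move=> u /= [[]]].
      by apply: measurableI => //; exact: measurableC.
    by apply: measurableI => //; exact: measurableC.
  have l2 : fine (K ([set u | u.1 <= b /\ u.2 <= c] `&` [set u | u.1 <= a]))
      <= bicdf K (a, c).
    apply: pr_le; [exact: measurableI|exact: m12|].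
    by move=> u /= [[]].
  have l3 : fine (K ([set u | u.1 <= b] `&` [set u | u.1 <= a])) = margin1 K a.
    congr (fine (K _)); apply/seteqP; split=> u /= => [[]//|ua].
    by split=> //; exact: le_trans (ltW ab).
  rewrite [X in X <= _]e1 [margin1 K b]e2 l3; lra.
have key2 a b c : bicdf K (c, b) <= bicdf K (c, a) + `|margin2 K b - margin2 K a|.
  have [ba|ab] := leP b a.
    apply: ler_wpDr => //; apply: pr_le => // u /= [u1 u2].
    by split=> //; exact: le_trans ba.
  have nd := margin2_nd (ltW ab); rewrite ger0_norm ?subr_ge0//.
  have e1 := pr_splitI K (m12 c b) (m2 a).
  have e2 := pr_splitI K (m2 b) (m2 a).
  have l1 : fine (K ([set u | u.1 <= c /\ u.2 <= b] `&` ~` [set u | u.2 <= a]))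
      <= fine (K ([set u | u.2 <= b] `&` ~` [set u | u.2 <= a])).
    apply: pr_le; [| |by move=> u /= [[]]].
      by apply: measurableI => //; exact: measurableC.
    by apply: measurableI => //; exact: measurableC.
  have l2 : fine (K ([set u | u.1 <= c /\ u.2 <= b] `&` [set u | u.2 <= a]))
      <= bicdf K (c, a).
    apply: pr_le; [exact: measurableI|exact: m12|].
    by move=> u /= [[]].
  have l3 : fine (K ([set u | u.2 <= b] `&` [set u | u.2 <= a])) = margin2 K a.
    congr (fine (K _)); apply/seteqP; split=> u /= => [[]//|ua].
    by split=> //; exact: le_trans (ltW ab).
  rewrite [X in X <= _]e1 [margin2 K b]e2 l3; lra.
by have := key1 x x' y'; have := key2 y y' x; lra.
Qed.

Lemma bicdf_continuous x y : {for x, continuous (margin1 K)} ->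
  {for y, continuous (margin2 K)} -> {for (x, y), continuous (bicdf K)}.
Proof.
move=> c1 c2; apply/cvgrPdist_lt => e e0.
have e20 : 0 < e / 2 by rewrite divr_gt0.
have /cvgrPdist_lt /(_ _ e20) h1 : margin1 K u.1 @[u --> (x, y)] --> margin1 K x.
  by exact: (cvg_comp (fst : R * R -> R) (margin1 K) cvg_fst c1).
have /cvgrPdist_lt /(_ _ e20) h2 : margin2 K u.2 @[u --> (x, y)] --> margin2 K y.
  by exact: (cvg_comp (snd : R * R -> R) (margin2 K) cvg_snd c2).
near=> u.
have k1 : `|margin1 K x - margin1 K u.1| < e / 2 by near: u.
have k2 : `|margin2 K y - margin2 K u.2| < e / 2 by near: u.
have := bicdf_modulus x y u.1 u.2; have := bicdf_modulus u.1 u.2 x y.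
rewrite -surjective_pairing (distrC (margin1 K u.1)) (distrC (margin2 K u.2)).
by rewrite ltr_norml => ? ?; apply/andP; split; lra.
Unshelve. all: by end_near. Qed.

(** Tightness of the limit law along its continuity points. *)
Lemma continuity_corner e (x0 : R) : 0 < e -> exists x y,
  [/\ x0 < x, {for x, continuous (margin1 K)}, {for y, continuous (margin2 K)},
      {for (x, y), continuous (bicdf K)} & 1 - e < bicdf K (x, y)].
Proof.
move=> e0; have e20 : 0 < e / 2 by rewrite divr_gt0.
have [x1 hx1] := tail_y0 fst_rv e20; have [y1 hy1] := tail_y0 snd_rv e20.
have dense (F : R -> R) (a b : R) : {homo F : x y / x <= y} ->
    exists2 x : R, Num.max a b < x & {for x, continuous F}.
  move=> ndF; have lt : Num.max a b < Num.max a b + 1 by rewrite ltrDl.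
  by have [x /andP[ax _] cx] := monotone_continuity_dense ndF lt; exists x.
have [x + cx] := dense _ x0 x1 margin1_nd.
have [y + cy] := dense _ y1 y1 margin2_nd.
rewrite !gt_max => /andP[y1y _] /andP[x0x x1x].
exists x, y; split=> //; first exact: bicdf_continuous.
apply: lt_le_trans (margins_le_bicdf x y).
have := tail_ni fst_rv (ltW x1x).
have := tail_ni snd_rv (ltW y1y).
by rewrite margin1_tail margin2_tail; lra.
Qed.

End margins.

(** * Conditional limits given a large first coordinate *)

Section cond_prob.
Context (R : realType) (d : measure_display) (T : measurableType d).
Context (P : probability T R) (B : set T).
Context (mB : measurable B).
Context (B0 : 0 < fine (P B)).

Lemma cond_prob_le A A' : measurable A -> measurable A' -> A `<=` A' ->
  cond_prob P A B <= cond_prob P A' B.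
Proof.
move=> mA mA' AA'; rewrite ler_pM2r ?invr_gt0//.
by apply: pr_le; [exact: measurableI|exact: measurableI|exact: setSI].
Qed.

Lemma cond_prob_setC A : measurable A ->
  cond_prob P (~` A) B = 1 - cond_prob P A B.
Proof.
move=> mA; rewrite /cond_prob -[X in X - _](divff (lt0r_neq0 B0)) -mulrBl.
congr (_ / _); rewrite [in RHS](pr_splitI P mB mA).
by rewrite [B `&` A]setIC [B `&` ~` A]setIC addrAC subrr add0r.
Qed.

Lemma cond_prob_setI_ge A A' : measurable A -> measurable A' ->
  cond_prob P A B <= cond_prob P (A `&` A') B + (1 - cond_prob P A' B).
Proof.
move=> mA mA'; rewrite -cond_prob_setC// /cond_prob -mulrDl.
rewrite ler_pM2r ?invr_gt0//.
rewrite (pr_splitI P (measurableI _ _ mA mB) mA') (setIAC A B A') lerD2l.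
apply: pr_le; [| |by move=> w /= [[]]].
  by do 2 ?apply: measurableI => //; exact: measurableC.
by apply: measurableI => //; exact: measurableC.
Qed.

End cond_prob.

Section conditional_limit.
Context (R : realType) (d : measure_display) (T : measurableType d).
Context (P : probability T R) (X Y : {RV P >-> R}).
Context (m a psi : R -> R) (K : probability (R * R)%type R).
Context (X_endpoint : forall x : R, 0 < tail X x).
Context (psi_gt0 : forall t : R, 0 < psi t).
Context (K_support : K [set z | 0 <= z.1] = 1%E).
Context (K_margins : nondegenerate_margins K).
Context (cond_limit : forall x y : R, 0 <= x ->
  {for (x, y), continuous (bicdf K)} ->
  cond_prob P
    [set w | X w <= t + psi t * x /\ Y w <= m t + a t * y]
    [set w | t < X w] @[t --> +oo] --> bicdf K (x, y)).

Let mX x := measurable_cdf_set X x.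
Let mY x := measurable_cdf_set Y x.
Let mXY x y : measurable [set w | X w <= x /\ Y w <= y].
Proof. exact: (measurableI _ _ (mX x) (mY y)). Qed.
Let mB t := measurable_tail_set X t.
Let B0 t : 0 < fine (P [set w | t < X w]).
Proof. by rewrite -tailE. Qed.

(** As [K] is a probability measure, some corner captures almost all of it; the
    constraint on the first coordinate may then be dropped. *)
Lemma cond_limit_Y e : 0 < e -> exists y, \forall t \near +oo,
  1 - e < cond_prob P [set w | Y w <= m t + a t * y] [set w | t < X w].
Proof.
move=> e0; have [x [y [x0 _ _ cK K1]]] := continuity_corner K 0 e0.
exists y; have ev := cvgr_gt _ (cond_limit (ltW x0) cK) _ K1.
near=> t; apply: (@lt_le_trans _ _ (cond_prob P
  [set w | X w <= t + psi t * x /\ Y w <= m t + a t * y] [set w | t < X w])).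
  by near: t; exact: ev.
by apply: cond_prob_le => // w [].
Unshelve. all: by end_near. Qed.

Lemma excess_cond_prob t x : 0 < x -> tail X (t + psi t * x) / tail X t =
  1 - cond_prob P [set w | X w <= t + psi t * x] [set w | t < X w].
Proof.
move=> x0; rewrite -cond_prob_setC// /cond_prob -tailE; congr (_ / _).
rewrite tailE; congr (fine (P _)); apply/seteqP; split=> w /=.
  move=> h; split; first by apply/negP; rewrite -ltNge.
  by apply: lt_trans h; rewrite ltrDl mulr_gt0.
by move=> [/negP]; rewrite -ltNge.
Qed.

(** Passing from the joint limit to the margin: no conditional mass escapes at
    infinity in the second coordinate, because the limit [K] is itself a
    probability measure. *)
Lemma excess_cvg_margin x : 0 < x -> {for x, continuous (margin1 K)} ->
  tail X (t + psi t * x) / tail X t @[t --> +oo] --> tail (fst_rv K) x.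
Proof.
move=> x0 cx; apply/cvgrPdist_lt => e e0.
have e30 : 0 < e / 3 by rewrite divr_gt0.
have [x' [y [xx' _ cy cK K1]]] := continuity_corner K x e30.
have cKx := bicdf_continuous cx cy.
have Kup := bicdf_le_margin1 K x y.
have Klo : margin1 K x - e / 3 < bicdf K (x, y).
  have := margins_le_bicdf K x y.
  have : bicdf K (x', y) <= margin2 K y.
    apply: pr_le => [| |u /= []//].
      exact: (measurableI _ _ (measurable_cdf_set (fst_rv K) x')
                              (measurable_cdf_set (snd_rv K) y)).
    exact: (measurable_cdf_set (snd_rv K) y).
  lra.
have ev1 := cvgr_gt _ (cond_limit (ltW (lt_trans x0 xx')) cK) _ K1.
have ev2 := cvgr_gt _ (cond_limit (ltW x0) cKx) _ Klo.
have Kup' : bicdf K (x, y) < margin1 K x + e / 3 by lra.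
have ev3 := cvgr_lt _ (cond_limit (ltW x0) cKx) _ Kup'.
pose cp t A := cond_prob P A [set w | t < X w].
near=> t.
have h1 : 1 - e / 3 < cp t [set w | X w <= t + psi t * x' /\ Y w <= m t + a t * y].
  by near: t; exact: ev1.
have h2 : margin1 K x - e / 3 <
    cp t [set w | X w <= t + psi t * x /\ Y w <= m t + a t * y].
  by near: t; exact: ev2.
have h3 : cp t [set w | X w <= t + psi t * x /\ Y w <= m t + a t * y] <
    margin1 K x + e / 3.
  by near: t; exact: ev3.
have h4 : cp t [set w | X w <= t + psi t * x' /\ Y w <= m t + a t * y] <=
    cp t [set w | Y w <= m t + a t * y].
  by apply: cond_prob_le => // w [].
have h5 : cp t [set w | X w <= t + psi t * x /\ Y w <= m t + a t * y] <=
    cp t [set w | X w <= t + psi t * x].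
  by apply: cond_prob_le => // w [].
have h6 := cond_prob_setI_ge (mB t) (B0 t) (mX (t + psi t * x))
  (mY (m t + a t * y)).
rewrite -!/(cp t _) -[_ `&` _]/[set w | X w <= _ /\ Y w <= _] in h6.
rewrite excess_cond_prob// -/(cp t _); rewrite margin1_tail in h2 h3.
by rewrite ltr_norml; apply/andP; split; lra.
Unshelve. all: by end_near. Qed.

Lemma fst_tail_neg x : x < 0 -> tail (fst_rv K) x = 1.
Proof.
move=> x0; apply/eqP; rewrite eq_le tail_le1 tailE/=.
have <- : fine (K [set z | 0 <= z.1]) = 1 by rewrite K_support.
apply: pr_le => [| |z /=]; last exact: lt_le_trans.
  rewrite (_ : [set z | _] = fst_rv K @^-1` `[0, +oo[).
    by rewrite -[X in measurable X]setTI; exact: measurable_funPT.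
  by apply/seteqP; split=> z /=; rewrite in_itv/= andbT.
exact: (measurable_tail_set (fst_rv K)).
Qed.

(** A nondegenerate limit for the excesses of [X] forces [X] into a domain of
    attraction, which is expressed here through its quantiles. *)
Lemma first_margin_limit : exists E : R -> R,
  {in Num.pos &, {homo E : s r / s < r}} /\
  forall s, 0 < s ->
    t * tail X (tail_inverse X t + psi (tail_inverse X t) * E s)
      @[t --> +oo] --> s^-1.
Proof.
have sf := tail_unbounded_survival X_endpoint.
pose H := tail (fst_rv K).
have sH : excess_survival H.
  split; [exact: tail_ni| |exact: tail_rc|exact: tail_y0|exact: fst_tail_neg].
  by move=> x; rewrite tail_ge0 tail_le1.
have H_nondeg e : ~ ((forall z, z < e -> H z = 1) /\ H e = 0).
  by move=> [lo up]; apply: (K_margins.1 e); exact: (tail_dirac lo up).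
have C_dense x y : x < y ->
    exists2 z, x < z < y & {for z, continuous (margin1 K)}.
  exact/monotone_continuity_dense/margin1_nd.
have Hdec := excess_decreasing sf psi_gt0 sH H_nondeg C_dense excess_cvg_margin.
have Honto := excess_onto sf psi_gt0 sH H_nondeg C_dense excess_cvg_margin.
have Hcvg :=
  excess_cvg_everywhere sf psi_gt0 sH H_nondeg C_dense excess_cvg_margin.
have [E [EP Elt]] :=
  quantile_limit sf psi_gt0 (tail_ni (fst_rv K)) Hdec Honto Hcvg.
exists E; split => // s s0.
exact: (tail_quantile_limit sf psi_gt0 EP Elt s0).
Qed.

End conditional_limit.

(** * The second margin *)

(** The solution [y] of [- ln (evd gamma y) = s^-1]. *)
Definition evd_quantile (R : realType) (gamma s : R) : R :=
  if gamma == 0 then ln s else (s `^ gamma - 1) / gamma.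

Section evd_quantile.
Context (R : realType) (gamma : R).
Local Notation E := (evd_quantile gamma).

Lemma evd_quantile_dom s : 0 < s -> 0 < 1 + gamma * E s.
Proof.
move=> s0; rewrite /evd_quantile; have [->|g0] := eqVneq gamma 0.
  by rewrite mul0r addr0.
by rewrite mulrC divfK// subrKC powR_gt0.
Qed.

Lemma evd_quantileK s : 0 < s -> - ln (evd gamma (E s)) = s^-1.
Proof.
move=> s0; rewrite /evd /evd_quantile; have [_|g0] := eqVneq gamma 0.
  by rewrite expRK opprK -lnV ?posrE// lnK// posrE invr_gt0.
rewrite expRK opprK mulrC divfK// subrKC -powRrM mulrN divff//.
by rewrite powR_inv1// ltW.
Qed.

Lemma evd_quantile1 : E 1 = 0.
Proof.
by rewrite /evd_quantile powR1 subrr mul0r ln1; case: ifP.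
Qed.

Lemma evd_quantile_lt : {in Num.pos &, {homo E : s r / s < r}}.
Proof.
move=> s r; rewrite !posrE => s0 r0 sr; rewrite /evd_quantile.
have [_|g0] := eqVneq gamma 0; first by rewrite ltr_ln.
have lt : ln s < ln r by rewrite ltr_ln.
rewrite /powR !gt_eqF//; have [g|g|/eqP] := ltgtP gamma 0; last by rewrite (negbTE g0).
  rewrite ltr_nM2r ?invr_lt0// ltrD2r ltr_expR.
  by rewrite ltr_nM2l.
by rewrite ltr_pM2r ?invr_gt0// ltrD2r ltr_expR ltr_pM2l.
Qed.

End evd_quantile.

Section Y_limit.
Context (R : realType) (d : measure_display) (T : measurableType d).
Context (P : probability T R) (Y : {RV P >-> R}) (gamma : R) (psiY : R -> R).
Context (Y_endpoint : forall x : R, 0 < tail Y x).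
Context (Y_domain : in_evd_domain Y gamma psiY).
Local Notation E := (evd_quantile gamma).

Let sf := tail_unbounded_survival Y_endpoint.

Let Ycvg s : 0 < s ->
  tail Y (t + psiY t * E s) / tail Y t @[t --> +oo] --> s^-1.
Proof.
move=> s0; rewrite -(evd_quantileK gamma s0).
exact/Y_domain/evd_quantile_dom.
Qed.

(** A step at the scale of the auxiliary function strictly decreases the tail, so
    that it goes to the right. *)
Lemma auxiliary_gt0 : \forall t \near +oo, 0 < psiY t.
Proof.
have two0 : 0 < 2 :> R by lra.
have h : (2 : R)^-1 < 1 by rewrite invf_lt1//; lra.
have E2 : 0 < E 2.
  by rewrite -(evd_quantile1 gamma); apply: evd_quantile_lt; rewrite ?posrE//; lra.
have ev := cvgr_lt _ (Ycvg two0) _ h; near=> t.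
have : tail Y (t + psiY t * E 2) / tail Y t < 1 by near: t; exact: ev.
rewrite ltr_pdivrMr// mul1r ltNge => h1; rewrite ltNge; apply/negP => p0.
move/negP: h1; apply; apply: tail_ni.
by rewrite gerDl mulr_le0_ge0// ltW.
Unshelve. all: by end_near. Qed.

(** For a level [s < 1] one has [E s < 0]: the point [U + psiY U * E s] is below
    the quantile [U], so its tail exceeds [t^-1], and it is comparable to the tail
    at [U]. *)
Lemma second_margin_atomless : t * tail Y (tail_inverse Y t) @[t --> +oo] --> (1 : R).
Proof.
apply: (@cvg_between _ _ _ _ _ _ 1) => // x /andP[]; last first.
  move=> x1 _; near=> t.
  have t1 : 1 < t by near: t; apply: nbhs_pinfty_gt; exact: num_real.
  exact: le_trans (inv_tail_mass_le1 sf t1) (ltW x1).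
rewrite subrr => x0 x1; pose s := (1 + x) / 2.
have s0 : 0 < s by rewrite /s; lra.
have Es : E s < 0.
  by rewrite -(evd_quantile1 gamma); apply: evd_quantile_lt; rewrite ?posrE// /s; lra.
have sx : s^-1 < x^-1 by rewrite ltf_pV2 ?posrE// /s; lra.
have ev := cvgr_lt _ (cvg_comp _ _ (inv_tail_cvg sf) (Ycvg s0)) _ sx.
have ev2 : \forall t \near +oo, 0 < psiY (inv_tail (tail Y) t).
  exact: (inv_tail_cvg sf) _ auxiliary_gt0.
near=> t.
have t1 : 1 < t by near: t; apply: nbhs_pinfty_gt; exact: num_real.
have t0 : 0 < t by exact: lt_trans t1.
have p0 : 0 < psiY (inv_tail (tail Y) t) by near: t; exact: ev2.
have : tail Y (tail_inverse Y t + psiY (tail_inverse Y t) * E s) /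
    tail Y (tail_inverse Y t) < x^-1 by near: t; exact: ev.
have : t^-1 < tail Y (tail_inverse Y t + psiY (tail_inverse Y t) * E s).
  by apply: (gt_inv_tail sf) => //; rewrite gtrDl nmulr_llt0.
rewrite ltr_pdivrMr// => /lt_trans/[apply].
by rewrite mulrC ltr_pdivlMr// mulrC ltr_pdivrMr// mulrC => /ltW.
Unshelve. all: by end_near. Qed.

Lemma second_margin_limit s : 0 < s ->
  t * tail Y (tail_inverse Y t + psiY (tail_inverse Y t) * E s)
    @[t --> +oo] --> s^-1.
Proof.
move=> s0; rewrite -[s^-1]mul1r.
apply: (cvg_ext (cvgM second_margin_atomless (cvg_comp _ _ (inv_tail_cvg sf) (Ycvg s0)))).
by move=> t /=; rewrite -[RHS]mulrA; congr (_ * _); rewrite [RHS]mulrC divfK// gt_eqF.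
Qed.

End Y_limit.

(** * Joint exceedances are negligible *)

Section joint_tail.
Context (R : realType) (d : measure_display) (T : measurableType d).
Context (P : probability T R) (X Y : {RV P >-> R}) (m a : R -> R).
Context (X_endpoint : forall x : R, 0 < tail X x).
Context (Y_endpoint : forall x : R, 0 < tail Y x).
Context (a_gt0 : forall t : R, 0 < a t).
Context (cond_Y : forall e : R, 0 < e -> exists y, \forall t \near +oo,
  1 - e < cond_prob P [set w | Y w <= m t + a t * y] [set w | t < X w]).
Context (separation :
  (tail_inverse Y t - m (tail_inverse X t)) / a (tail_inverse X t)
    @[t --> +oo] --> +oo).

Let sX := tail_unbounded_survival X_endpoint.
Let sY := tail_unbounded_survival Y_endpoint.

(** The separation condition places the quantile of [Y] beyond every level at
    which [Y] lives given that [X] exceeds its own quantile. *)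
Lemma joint_tail_at_quantiles :
  t * fine (P [set w | tail_inverse X t < X w /\ tail_inverse Y t < Y w])
    @[t --> +oo] --> (0 : R).
Proof.
apply/cvgrPdist_lt => e e0.
have [y hy] := cond_Y e0.
have ev1 : \forall t \near +oo, 1 - e < cond_prob P
    [set w | Y w <= m (tail_inverse X t) + a (tail_inverse X t) * y]
    [set w | tail_inverse X t < X w].
  exact: (inv_tail_cvg sX) _ hy.
have ev2 : \forall t \near +oo, y <=
    (tail_inverse Y t - m (tail_inverse X t)) / a (tail_inverse X t).
  by move/cvgryPge : separation; exact.
near=> t.
have t1 : 1 < t by near: t; apply: nbhs_pinfty_gt; exact: num_real.
have t0 : 0 < t by exact: lt_trans t1.
have vt : y <=
    (tail_inverse Y t - m (tail_inverse X t)) / a (tail_inverse X t).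
  by near: t; exact: ev2.
have ct : 1 - e < cond_prob P
    [set w | Y w <= m (tail_inverse X t) + a (tail_inverse X t) * y]
    [set w | tail_inverse X t < X w] by near: t; exact: ev1.
set u := tail_inverse X t; set v := tail_inverse Y t.
pose C := [set w | Y w <= m u + a u * y].
have mC : measurable C by exact: measurable_cdf_set.
have mU := measurable_tail_set X u.
have mV := measurable_tail_set Y v.
have yv : m u + a u * y <= v.
  by rewrite -lerBrDl mulrC -ler_pdivlMr.
have cC : 1 - e < cond_prob P C [set w | u < X w] by exact: ct.
have PU : 0 < fine (P [set w | u < X w]) by rewrite -tailE.
have tU : t * fine (P [set w | u < X w]) <= 1.
  by rewrite -tailE; exact: (inv_tail_mass_le1 sX).
have : fine (P [set w | u < X w /\ v < Y w]) <= fine (P ((~` C) `&` [set w | u < X w])).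
  apply: pr_le; [exact: measurableI|apply: measurableI => //; exact: measurableC|].
  move=> w /= [uX vY]; split => //; apply/negP; rewrite -ltNge.
  exact: le_lt_trans vY.
have := cond_prob_setC mU PU mC; rewrite {1}/cond_prob.
move=> /(canRL (divfK (lt0r_neq0 PU))) ->.
move=> h; rewrite sub0r normrN ger0_norm; last by rewrite mulr_ge0 ?pr_ge0// ltW.
apply: (@le_lt_trans _ _ ((1 - cond_prob P C [set w | u < X w]) *
   (t * fine (P [set w | u < X w])))).
  by rewrite mulrCA ler_wpM2l// ltW.
have h1 : 1 - cond_prob P C [set w | u < X w] < e by lra.
have [h2|h2] := leP 0 (1 - cond_prob P C [set w | u < X w]).
  apply: le_lt_trans h1; rewrite -[leRHS]mulr1; exact: ler_wpM2l.
apply: le_lt_trans e0; apply: mulr_le0_ge0; first exact: ltW.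
by rewrite mulr_ge0 ?pr_ge0// ltW.
Unshelve. all: by end_near. Qed.

(** Levels with bounded expected numbers of exceedances, at most [L], lie above
    the quantiles at [n.+1%:R / L], so [joint_tail_at_quantiles] applies
    whatever the normalization. *)
Lemma joint_tail_negligible (u v : nat -> R) (L : R) : 0 < L ->
  (\forall n \near \oo, n.+1%:R * tail X (u n) <= L) ->
  (\forall n \near \oo, n.+1%:R * tail Y (v n) <= L) ->
  n.+1%:R * fine (P [set w | u n < X w /\ v n < Y w]) @[n --> \oo] --> (0 : R).
Proof.
move=> L0 hu hv.
have NL : n.+1%:R / L @[n --> \oo] --> +oo.
  apply/cvgryPge => A; near=> n; rewrite ler_pdivlMr//.
  have : A * L <= n%:R by near: n; exact: nbhs_infty_ger.
  by move=> /le_trans; apply; rewrite ler_nat.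
have cv := cvg_comp _ _ NL joint_tail_at_quantiles.
have up : L * (n.+1%:R / L * fine (P [set w | tail_inverse X (n.+1%:R / L) < X w
    /\ tail_inverse Y (n.+1%:R / L) < Y w])) @[n --> \oo] --> (0 : R).
  by rewrite -[X in _ --> X](mulr0 L); apply: cvgM => //; exact: cvg_cst.
have lo : (fun _ : nat => 0 : R) @ \oo --> (0 : R) by exact: cvg_cst.
apply: squeeze_cvgr lo up; near=> n.
have t1 : 1 < n.+1%:R / L by near: n; exact: (cvgryPgt _).1 NL 1.
have t0 : 0 < n.+1%:R / L by exact: lt_trans t1.
rewrite mulr_ge0 ?pr_ge0//= mulrA mulrC [L * _]mulrC divfK ?gt_eqF// mulrC.
rewrite ler_wpM2l//; apply: pr_le.
- exact: (measurableI _ _ (measurable_tail_set X _) (measurable_tail_set Y _)).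
- exact: (measurableI _ _ (measurable_tail_set X _) (measurable_tail_set Y _)).
move=> w /= [uX vY]; split; [apply: le_lt_trans uX|apply: le_lt_trans vY].
- apply: (inv_tail_le sX) => //; rewrite invf_div ler_pdivlMr// mulrC.
  by near: n; exact: hu.
- apply: (inv_tail_le sY) => //; rewrite invf_div ler_pdivlMr// mulrC.
  by near: n; exact: hv.
Unshelve. all: by end_near. Qed.

End joint_tail.

(** * Powers of the joint distribution function *)

Section powers.
Context (R : realType).

Lemma pow_le_exp (q : R) n : q <= 1 -> (1 - q) ^+ n <= expR (- (n%:R * q)).
Proof.
move=> q1; rewrite -mulrN expRM_natl lerXn2r ?nnegrE ?subr_ge0// ?expR_ge0//.
exact: expR_ge1Dx.
Qed.

Lemma pow_ge_exp (q : R) n : q < 1 ->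
  expR (- (n%:R * q / (1 - q))) <= (1 - q) ^+ n.
Proof.
move=> q1; have q0 : 0 < 1 - q by rewrite subr_gt0.
rewrite -mulrA -mulrN expRM_natl lerXn2r ?nnegrE ?expR_ge0//; first exact: ltW.
rewrite expRN -[leRHS]invrK lef_pV2 ?posrE ?expR_gt0 ?invr_gt0//.
apply: le_trans (expR_ge1Dx _); rewrite le_eqVlt; apply/orP; left; apply/eqP.
by field; rewrite gt_eqF.
Qed.

(** Poisson approximation: [1 - q] is squeezed between [expR (- (q / (1 - q)))]
    and [expR (- q)]. *)
Lemma pow_exp_cvg (q : nat -> R) (l : R) : (forall n, q n <= 1) ->
  n.+1%:R * q n @[n --> \oo] --> l ->
  (1 - q n) ^+ n.+1 @[n --> \oo] --> expR (- l).
Proof.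
move=> q1 ql.
have q0 : q n @[n --> \oo] --> (0 : R).
  rewrite -(mul0r l); apply: (cvg_ext (cvgM (@cvg_harmonic R) ql)) => n /=.
  by rewrite mulrA mulVf ?mul1r// pnatr_eq0.
have lo : expR (- (n.+1%:R * q n / (1 - q n))) @[n --> \oo] --> expR (- l).
  apply: continuous_cvg; first exact: continuous_expR.
  apply: cvgN; rewrite -[l]divr1; apply: cvgM => //; apply: cvgV => //.
  by rewrite -[X in _ --> X]subr0; apply: cvgB => //; exact: cvg_cst.
have up : expR (- (n.+1%:R * q n)) @[n --> \oo] --> expR (- l).
  apply: continuous_cvg; first exact: continuous_expR.
  exact: cvgN.
apply: squeeze_cvgr lo up; near=> n; rewrite pow_le_exp// andbT pow_ge_exp//.
by near: n; exact: cvgr_lt _ q0 _ ltr01.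
Unshelve. all: by end_near. Qed.

Lemma pow_exp_pinfty (q : nat -> R) : (forall n, q n <= 1) ->
  n.+1%:R * q n @[n --> \oo] --> +oo ->
  (1 - q n) ^+ n.+1 @[n --> \oo] --> (0 : R).
Proof.
move=> q1 /cvgryPgt ql; apply/cvgrPdist_lt => e e0.
have ev := ql (- ln e); near=> n.
have h : - ln e < n.+1%:R * q n by near: n.
rewrite sub0r normrN ger0_norm ?exprn_ge0 ?subr_ge0//.
apply: le_lt_trans (pow_le_exp _ (q1 n)) _.
by rewrite -[ltRHS]lnK ?posrE// ltr_expR ltrNl.
Unshelve. all: by end_near. Qed.

End powers.

(** The maximum of independent copies is below a point if and only if all the
    copies are. *)
Lemma max_probability (R : realType) (d d' : measure_display)
    (T : measurableType d) (S : measurableType d') (P : probability T R)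
    (Q : probability S R) (X Y : {RV P >-> R}) (n : nat)
    (Z : 'I_n.+1 -> {RV Q >-> (R * R)%type}) (a1 b1 a2 b2 : R) (z : R * R) :
  iid_copies P (fun w => (X w, Y w)) Z -> 0 < a1 -> 0 < a2 ->
  fine (Q [set w | let M := componentwise_max Z w in
    (M.1 - b1) / a1 <= z.1 /\ (M.2 - b2) / a2 <= z.2]) =
  fine (P [set w | X w <= b1 + a1 * z.1 /\ Y w <= b2 + a2 * z.2]) ^+ n.+1.
Proof.
move=> [lawZ indZ] a10 a20.
pose A : set (R * R) := [set u | u.1 <= b1 + a1 * z.1 /\ u.2 <= b2 + a2 * z.2].
have mA : measurable A.
  rewrite (_ : A = `]-oo, b1 + a1 * z.1]%classic `*` `]-oo, b2 + a2 * z.2]%classic).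
    by apply: measurableX.
  by apply/seteqP; split=> u /=; rewrite !in_itv/=.
rewrite (_ : [set w | _] = \bigcap_i (Z i @^-1` A)); last first.
  apply/seteqP; split=> w /=.
    rewrite !ler_pdivrMr// !lerBlDl ![_ * a1]mulrC ![_ * a2]mulrC.
    by move=> [/bigmax_leP[_ h1] /bigmax_leP[_ h2]] i _; split; [exact: h1|exact: h2].
  move=> h; rewrite !ler_pdivrMr// !lerBlDl ![_ * a1]mulrC ![_ * a2]mulrC.
  split; apply/bigmax_leP; split=> [|i _]; by [case: (h ord0 I)|case: (h i I)].
rewrite (indZ (fun=> A))//.
rewrite (eq_bigr (fun=> P [set w | X w <= b1 + a1 * z.1 /\
  Y w <= b2 + a2 * z.2])); last first.
  by move=> i _; rewrite lawZ.
rewrite (prE P (measurableI _ _ (measurable_cdf_set X (b1 + a1 * z.1))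
  (measurable_cdf_set Y (b2 + a2 * z.2)))).
by rewrite prodEFin/= prodr_const card_ord.
Qed.

Lemma joint_cdf_tail (R : realType) (d : measure_display) (T : measurableType d)
    (P : probability T R) (X Y : {RV P >-> R}) (u v : R) :
  fine (P [set w | X w <= u /\ Y w <= v]) =
  1 - (tail X u + tail Y v - fine (P [set w | u < X w /\ v < Y w])).
Proof.
rewrite !tailE.
have := pr_unionE P (measurable_tail_set X u) (measurable_tail_set Y v).
rewrite -[_ `&` _]/[set w | u < X w /\ v < Y w] => <-.
rewrite -pr_setC; last by apply: measurableU; exact: measurable_tail_set.
by rewrite setCU !setC_tail_set.
Qed.

Lemma cvg_natS (R : realType) : (n.+1%:R : R) @[n --> \oo] --> +oo.
Proof.
apply/cvgryPge => A; near=> n.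
have : A <= n%:R by near: n; exact: nbhs_infty_ger.
by move=> /le_trans; apply; rewrite ler_nat.
Unshelve. all: by end_near. Qed.

Section limit_of_maxima.
Context (R : realType) (d : measure_display) (T : measurableType d).
Context (P : probability T R) (X Y : {RV P >-> R}) (u v : nat -> R).
Local Notation tX := (fun n => n.+1%:R * tail X (u n)).
Local Notation tY := (fun n => n.+1%:R * tail Y (v n)).

Let q n := tail X (u n) + tail Y (v n) - fine (P [set w | u n < X w /\ v n < Y w]).

Let mJ n : measurable [set w | u n < X w /\ v n < Y w].
Proof. exact: (measurableI _ _ (measurable_tail_set X _) (measurable_tail_set Y _)). Qed.

Let q_le1 n : q n <= 1.
Proof.
by rewrite -subr_ge0 /q -joint_cdf_tail pr_ge0.
Qed.

Let pq n : fine (P [set w | X w <= u n /\ Y w <= v n]) = 1 - q n.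
Proof. exact: joint_cdf_tail. Qed.

Lemma maxima_cvg (x y : R) : tX @ \oo --> x -> tY @ \oo --> y ->
  n.+1%:R * fine (P [set w | u n < X w /\ v n < Y w]) @[n --> \oo] --> (0 : R) ->
  fine (P [set w | X w <= u n /\ Y w <= v n]) ^+ n.+1
    @[n --> \oo] --> expR (- (x + y)).
Proof.
move=> hx hy hj; apply: (cvg_ext (h := fun n => (1 - q n) ^+ n.+1)); last first.
  by move=> n; rewrite pq.
apply: pow_exp_cvg => //; rewrite -[x + y]subr0.
apply: (cvg_ext (cvgB (cvgD hx hy) hj)) => n /=.
by rewrite /q mulrBr mulrDr.
Qed.

Lemma maxima_cvg0 : tX @ \oo --> +oo \/ tY @ \oo --> +oo ->
  fine (P [set w | X w <= u n /\ Y w <= v n]) ^+ n.+1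
    @[n --> \oo] --> (0 : R).
Proof.
move=> h; apply: (cvg_ext (h := fun n => (1 - q n) ^+ n.+1)); last first.
  by move=> n; rewrite pq.
apply: pow_exp_pinfty => //.
have qX n : tail X (u n) <= q n.
  rewrite /q addrAC -addrA lerDl addrC subr_ge0 (tailE Y).
  by apply: pr_le => [||w []//]; [exact: mJ|exact: measurable_tail_set].
have qY n : tail Y (v n) <= q n.
  rewrite /q addrAC lerDr subr_ge0 (tailE X).
  by apply: pr_le => [||w []//]; [exact: mJ|exact: measurable_tail_set].
apply/cvgryPge => A; case: h => /cvgryPge /(_ A) h; apply: filterS h => n /le_trans; apply.
  by rewrite ler_wpM2l.
by rewrite ler_wpM2l.
Qed.

End limit_of_maxima.

(** * Asymptotic independence *)

Lemma product_law (R : realType) (mu nu : probability R R) :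
  exists G : probability (R * R)%type R, forall A B : set R,
    measurable A -> measurable B -> G (A `*` B) = (mu A * nu B)%E.
Proof.
have mnT : (mu \x nu)%E setT = 1%E.
  rewrite -setXTT; apply: (etrans (product_measure1E _ _ _ _)) => //.
  by rewrite -[LHS]/(mu setT * nu setT)%E !probability_setT mule1.
pose B := Measure_isProbability.Build _ _ _ (mu \x nu)%E mnT.
pose G : probability (R * R)%type R := HB.pack (mu \x nu)%E B.
by exists G => A C mA mC; exact: product_measure1E.
Qed.

Section product_margins.
Context (R : realType) (mu nu : probability R R).
Context (G : probability (R * R)%type R).
Context (GE : forall A B : set R, measurable A -> measurable B ->
  G (A `*` B) = (mu A * nu B)%E).

Lemma product_margin1 x : margin1 G x = fine (mu `]-oo, x]%classic).
Proof.
rewrite /margin1 (_ : [set u | _] = `]-oo, x]%classic `*` setT).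
  by rewrite GE// probability_setT mule1.
by apply/seteqP; split=> u /=; rewrite in_itv/= => // -[].
Qed.

Lemma product_margin2 x : margin2 G x = fine (nu `]-oo, x]%classic).
Proof.
rewrite /margin2 (_ : [set u | _] = setT `*` `]-oo, x]%classic).
  by rewrite GE// probability_setT mul1e.
by apply/seteqP; split=> u /=; rewrite in_itv/= => // -[].
Qed.

Lemma product_independent : independent_margins G.
Proof.
move=> x y; rewrite product_margin1 product_margin2.
rewrite /bicdf (_ : [set u | _] = `]-oo, x]%classic `*` `]-oo, y]%classic).
  by rewrite GE// fineM// fin_num_measure.
by apply/seteqP; split=> u /=; rewrite !in_itv/=.
Qed.

Lemma product_nondegenerate : (forall c, mu [set c] <> 1%E) ->
  (forall c, nu [set c] <> 1%E) -> nondegenerate_margins G.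
Proof.
move=> mu1 nu1; split=> c.
  rewrite (_ : [set u | _] = [set c] `*` setT).
    by rewrite GE// probability_setT mule1; exact: mu1.
  by apply/seteqP; split=> u /=; [|case].
rewrite (_ : [set u | _] = setT `*` [set c]).
  by rewrite GE// probability_setT mul1e; exact: nu1.
by apply/seteqP; split=> u /=; [|case].
Qed.

End product_margins.

Theorem proposition4 (R : realType) (d : measure_display)
    (T : measurableType d) (P : probability T R) (X Y : {RV P >-> R})
    (X_endpoint : forall x : R, 0 < tail X x)
    (Y_endpoint : forall y : R, 0 < tail Y y)
    (m a psi : R -> R)
    (a_gt0 : forall t : R, 0 < a t) (psi_gt0 : forall t : R, 0 < psi t)
    (K : probability (R * R)%type R)
    (K_support : K [set z | 0 <= z.1] = 1%E)
    (K_margins : nondegenerate_margins K)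
    (cond_limit : forall x y : R, 0 <= x ->
       {for (x, y), continuous (bicdf K)} ->
       cond_prob P
         [set w | X w <= t + psi t * x /\ Y w <= m t + a t * y]
         [set w | t < X w] @[t --> +oo] --> bicdf K (x, y))
    (gamma : R) (psiY : R -> R)
    (Y_domain : in_evd_domain Y gamma psiY)
    (separation : forall y : R,
       (tail_inverse Y t - m (tail_inverse X t) + psiY (tail_inverse Y t) * y)
         / a (tail_inverse X t) @[t --> +oo] --> +oo) :
  asymptotically_independent X Y.
Proof.
have sX := tail_unbounded_survival X_endpoint.
have sY := tail_unbounded_survival Y_endpoint.
have [EX [EXlt EXcv]] := first_margin_limit X_endpoint psi_gt0
  K_support K_margins cond_limit.
have EYlt := evd_quantile_lt gamma.
have EYcv := second_margin_limit Y_endpoint Y_domain.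
have [mu muP] := quantile_law_exists EXlt.
have [nu nuP] := quantile_law_exists EYlt.
have [G GE] := product_law mu nu.
exists G; split; last exact: product_independent GE.
split.
  apply: (product_nondegenerate GE).
    exact: (quantile_law_nondegenerate muP).
  exact: (quantile_law_nondegenerate nuP).
pose b1 (n : nat) := tail_inverse X n.+1%:R.
pose b2 (n : nat) := tail_inverse Y n.+1%:R.
pose a1 n := psi (b1 n).
(* the auxiliary function is positive at high thresholds only *)
pose a2 n := if 0 < psiY (b2 n) then psiY (b2 n) else 1.
have a1_gt0 n : 0 < a1 n by exact: psi_gt0.
have a2_gt0 n : 0 < a2 n by rewrite /a2; case: ifP.
exists a1, b1, a2, b2; split=> //; split=> // d' S Q Z iidZ z _.
rewrite (_ : (fun n => _) = (fun n => fine (P [set w |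
    X w <= b1 n + a1 n * z.1 /\ Y w <= b2 n + a2 n * z.2]) ^+ n.+1)); last first.
  by apply/funext => n; exact: max_probability.
have b2_cvg : b2 @ \oo --> +oo := cvg_comp _ _ (@cvg_natS R) (inv_tail_cvg sY).
have Xs s : 0 < s -> n.+1%:R * tail X (b1 n + a1 n * EX s) @[n --> \oo] --> s^-1.
  by move=> s0; exact: (cvg_comp _ _ (@cvg_natS R) (EXcv s s0)).
have Ys s : 0 < s -> n.+1%:R * tail Y (b2 n + a2 n * evd_quantile gamma s)
    @[n --> \oo] --> s^-1.
  move=> s0; apply: (cvg_near_ext (cvg_comp _ _ (@cvg_natS R) (EYcv s s0))).
  have ev : \forall n \near \oo, 0 < psiY (b2 n).
    exact: b2_cvg _ (auxiliary_gt0 Y_endpoint Y_domain).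
  by near=> n => /=; rewrite /a2 ifT//; near: n; exact: ev.
have N0 n : 0 <= n.+1%:R :> R by [].
have a1_ge0 n := ltW (a1_gt0 n); have a2_ge0 n := ltW (a2_gt0 n).
pose g1 := fine (mu `]-oo, z.1]%classic); pose g2 := fine (nu `]-oo, z.2]%classic).
have Gz : bicdf G z = g1 * g2.
  rewrite [z]surjective_pairing (product_independent GE).
  by rewrite (product_margin1 GE) (product_margin2 GE).
rewrite Gz.
have : 0 <= g1 by exact: pr_ge0.
rewrite le_eqVlt => /predU1P[g10|g10].
  rewrite -g10 mul0r; apply: maxima_cvg0; left.
  exact: (intensity_pinfty muP _ (tail_ni X) N0 a1_ge0 Xs).
have : 0 <= g2 by exact: pr_ge0.
rewrite le_eqVlt => /predU1P[g20|g20].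
  rewrite -g20 mulr0; apply: maxima_cvg0; right.
  exact: (intensity_pinfty nuP _ (tail_ni Y) N0 a2_ge0 Ys).
have Xz := intensity_cvg muP eventually_filter (tail_ni X) (tail_ge0 X) N0 a1_ge0 Xs g10.
have Yz := intensity_cvg nuP eventually_filter (tail_ni Y) (tail_ge0 Y) N0 a2_ge0 Ys g20.
have -> : g1 * g2 = expR (- (- ln g1 + - ln g2)).
  by rewrite opprD !opprK expRD !lnK ?posrE.
apply: (maxima_cvg Xz Yz).
have cY := cond_limit_Y X_endpoint cond_limit.
have sep : (tail_inverse Y t - m (tail_inverse X t)) / a (tail_inverse X t)
    @[t --> +oo] --> +oo.
  rewrite (_ : (fun t => _) = (fun t => (tail_inverse Y t - m (tail_inverse X t)
    + psiY (tail_inverse Y t) * 0) / a (tail_inverse X t))); first exact: separation.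
  by apply/funext => t; rewrite mulr0 addr0.
pose L := Num.max (- ln g1) (- ln g2) + 1.
have [l1 l2] : - ln g1 < L /\ - ln g2 < L.
  by split; rewrite /L ltr_pwDr// le_max lexx ?orbT.
have L0 : 0 < L.
  by apply: le_lt_trans l1; rewrite oppr_ge0 ln_le0// pr_le1.
apply: (joint_tail_negligible X_endpoint Y_endpoint a_gt0 cY sep L0).
  by apply: filterS (cvgr_lt _ Xz _ l1) => n /ltW.
by apply: filterS (cvgr_lt _ Yz _ l2) => n /ltW.
Unshelve. all: by end_near. Qed.
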